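(* Let $\mathcal C$ be a Hilbertian von Neumann category supplied with a non-negative, normal and faithful trace $\tau$, and let $$(C,\partial):\ 0\to C^0\xrightarrow{\partial_1}C^1\xrightarrow{\partial_2}\cdots\xrightarrow{\partial_n}C^n\to0$$ be a chain complex in $\mathcal C$. Then $C$ is of $\tau$-determinant class if and only if the torsion parts $\mathcal T(\mathcal H^i(C))$ of its extended cohomology are $\tau$-trivial for all $i$.
   Context: **Von Neumann category.** A Hilbertian space is a topological vector space isomorphic to a Hilbert space; a scalar product on it is admissible if it defines a Hilbert space structure with the given topology. $H^*$ is the space of continuous anti-linear functionals, with $(\lambda\phi)(h)=\phi(\bar\lambda h)$. A Hilbertian von Neumann category $\mathcal C$ is an additive subcategory of the category of Hilbertian spaces and continuous linear maps (objects may carry extra structure; morphisms are faithfully represented by bounded linear maps) such that: (1) for each object $H$, $H^*$ is an object and there is a $\mathcal C$-isomorphism $\phi:H\to H^*$ such that $\langle x,y\rangle=\phi(x)(y)$ is an admissible scalar product; (2) the canonical isomorphism $H\to H^{**}$, $h\mapsto(\phi\mapsto\overline{\phi(h)})$, is in $\mathcal C$; (3) adjoints of morphisms are in $\mathcal C$; (4) kernels of morphisms and their inclusions are in $\mathcal C$; (5) $\mathrm{Hom}_{\mathcal C}(H,H')$ is a weakly closed linear subspace of the bounded operators. (Closures of images and quotients by them are then also in $\mathcal C$.) Scalar products as in (1) with $\phi\in\mathrm{Hom}_{\mathcal C}(H,H^* )$ are called $\mathcal C$-admissible. A trace $\tau$ assigns to each object $H$ a linear functional $\tau_H$ on the von Neumann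 algebra $\mathrm{Hom}_{\mathcal C}(H,H)$ with $\tau_{H_1}(gf)=\tau_{H_2}(fg)$ for $f:H_1\to H_2$, $g:H_2\to H_1$; it is non-negative if it is real and $\ge0$ on idempotents, and normal (faithful) if every $\tau_H$, $H\ne0$, is. **Extended category.** Objects of $\mathcal E(\mathcal C)$ are morphisms $(\alpha:A'\to A)$ of $\mathcal C$. A morphism $[f]:(\alpha:A'\to A)\to(\beta:B'\to B)$ is represented by $f:A\to B$ with $f\alpha=\beta f'$ for some $f':A'\to B'$; $f_1,f_2$ represent the same morphism iff $f_1-f_2=\beta F$ for some $F:A\to B'$ (all in $\mathcal C$). $\mathcal E(\mathcal C)$ is abelian. An object $(\alpha:A'\to A)$ is torsion if $\mathrm{im}\,\alpha$ is dense in $A$; the torsion part of $\mathcal X=(\alpha:A'\to A)$ is $\mathcal T(\mathcal X)=(\alpha:A'\to\mathrm{cl}(\mathrm{im}\,\alpha))$. The extended cohomology of $C$ is $\mathcal H^i(C)=(\partial_i:C^{i-1}\to\ker\partial_{i+1})\in\mathcal E(\mathcal C)$. **$\tau$-isomorphisms.** A morphism $\alpha:A'\to A$ of $\mathcal C$ is a $\tau$-isomorphism if it is injective, has dense image, and $\int_0^\infty\ln\lambda\,d\phi(\lambda)>-\infty$, where $(\alpha^*\alpha)^{1/2}=\int_0^\infty\lambda\,dE_\lambda$ is the spectral decomposition with respect to $\mathcal C$-admissible scalar products on $A',A$ (the condition does not depend on their choice) and $\phi(\lambda)=\tau(E_\lambda)$. A torsion object is $\tau$-trivial if it is isomorphic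 in $\mathcal E(\mathcal C)$ to some $(\alpha:A'\to A)$ with $\alpha$ a $\tau$-isomorphism. The complex $C$ is of $\tau$-determinant class if the induced maps $\partial_j:C^{j-1}/\ker\partial_j\to\mathrm{cl}(\mathrm{im}\,\partial_j)$ are $\tau$-isomorphisms for all $j$. *)

(* Defs.v *)
From HB Require Import structures.
From mathcomp Require Import all_boot all_order all_algebra.
From mathcomp Require Import all_classical all_reals all_analysis.
From mathcomp Require Import complex.

Set Implicit Arguments.
Unset Strict Implicit.
Unset Printing Implicit Defensive.

Import Order.TTheory GRing.Theory Num.Def Num.Theory.
Import numFieldNormedType.Exports.

Local Open Scope classical_set_scope.
Local Open Scope ring_scope.

Section HilbertianSpaces.
Context {R : realType}.
Implicit Types A B D H Q : topologicalLmodType R[i].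

Definition hnorm H (ip : {dot H for conjC}) (x : H) : R[i] := sqrtC (ip x x).

(* [{dot H for conjC}]: positive definite Hermitian form, linear in the first
   argument.  The order of [R[i]] only compares numbers with the same imaginary
   part, so [0 < e] forces [e] to be real. *)
Definition admissible H (ip : {dot H for conjC}) : Prop :=
  (forall (x : H) (U : set H), nbhs x U <->
     exists2 e : R[i], 0 < e & [set y | hnorm ip (y - x) < e] `<=` U) /\
  (forall u : nat -> H,
     (forall e : R[i], 0 < e -> exists N : nat, forall m n : nat,
        (N <= m)%N -> (N <= n)%N -> hnorm ip (u m - u n) < e) ->
     exists l : H, u @ \oo --> l).

Definition hilbertian H : Prop := exists ip : {dot H for conjC}, admissible ip.

Definition antilinear H (phi : H -> R[i]) : Prop :=
  forall (a : R[i]) (x y : H), phi (a *: x + y) = a^* * phi x + phi y.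

(* [ev] identifies [D] with the space of continuous antilinear functionals on
   [H], with the topology of the operator norm and the scalar multiplication
   [(a phi)(h) = phi (a^* h)]. *)
Definition is_antidual H D (ev : D -> H -> R[i]) : Prop :=
  [/\ forall (a : R[i]) (p q : D) (h : H),
        ev (a *: p + q) h = ev p (a^* *: h) + ev q h,
      forall p : D, antilinear (ev p) /\ continuous (ev p : H -> R[i]^o),
      injective ev,
      forall phi : H -> R[i], antilinear phi -> continuous (phi : H -> R[i]^o) ->
        exists p : D, ev p = phi
    & forall ip : {dot H for conjC}, admissible ip -> forall U : set D,
        nbhs 0 U <-> exists2 e : R[i], 0 < e &
          [set p | forall h, hnorm ip h <= 1 -> `|ev p h| <= e] `<=` U].

(* Inclusion of the subspace [V], with the topology induced by [B]. *)
Definition subspace_inclusion A B (i : A -> B) (V : set B) : Prop :=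
  [/\ linear i, injective i, range i = V
    & forall (x : A) (U : set A), nbhs x U <->
        exists2 W : set B, nbhs (i x) W & i @^-1` W `<=` U].

(* Projection onto [A / V], with the quotient topology. *)
Definition quotient_projection A Q (q : A -> Q) (V : set A) : Prop :=
  [/\ linear q, range q = setT, q @^-1` [set 0] = V
    & forall (x : A) (U : set Q), nbhs (q x) U <-> nbhs x (q @^-1` U)].

(* Order on operators; over the complex numbers [op_le ip (fun=> 0) T] already
   forces [T] to be self-adjoint. *)
Definition op_le H (ip : {dot H for conjC}) (S T : H -> H) : Prop :=
  forall x, ip (S x) x <= ip (T x) x.

Definition op_ge0 H (ip : {dot H for conjC}) (T : H -> H) : Prop :=
  op_le ip (fun=> 0) T.

Definition is_hilbert_adjoint A B (ipA : {dot A for conjC})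
    (ipB : {dot B for conjC}) (f : A -> B) (g : B -> A) : Prop :=
  forall x y, ipB (f x) y = ipA x (g y).

(* [T] is the nonnegative square root of [f^* f]. *)
Definition is_modulus A B (ipA : {dot A for conjC}) (ipB : {dot B for conjC})
    (f : A -> B) (T : A -> A) : Prop :=
  [/\ linear T, continuous T, op_ge0 ipA T
    & exists2 g : B -> A, is_hilbert_adjoint ipA ipB f g & T \o T = g \o f].

(* Right-continuous resolution of the identity [E], supported in [0, +oo), with
   [T = \int_0^oo l dE_l] in the weak sense. By polarization the diagonal
   entries [ip (E l x) x] suffice; they form a nondecreasing right-continuous
   real function of [l], packed here as the cumulative function [F]. *)
Definition is_spectral_family H (ip : {dot H for conjC}) (T : H -> H)
    (E : R -> H -> H) : Prop :=
  [/\ forall l, E l \o E l = E l /\ is_hilbert_adjoint ip ip (E l) (E l),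
      forall l m, l <= m -> E l \o E m = E l /\ E m \o E l = E l,
      forall l x, E m x @[m --> l^'+] --> E l x,
      (forall l, l < 0 -> E l = fun=> 0) /\
      (forall x, E l x @[l --> +oo%R] --> x)
    & forall x, exists F : cumulative R R,
        (forall l, ip (E l x) x = (F l)%:C%C) /\
        (\int[lebesgue_stieltjes_measure F]_(l in `[0%R, +oo[) l%:E =
           (complex.Re (ip (T x) x))%:E)%E].

End HilbertianSpaces.

(* Morphisms are the linear maps belonging to [mor A B]; distinct objects may
   have the same underlying space. The duality is a choice, for each object
   [H], of an object [dual H] whose space is identified with [H^*] by [ev]. *)
Record hvn_category (R : realType) := HvnCategory {
  obj :> Type;
  hspace : obj -> topologicalLmodType R[i];
  mor : forall A B : obj, set (hspace A -> hspace B);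
  dual : obj -> obj;
  ev : forall H : obj, hspace (dual H) -> hspace H -> R[i];
  zero_obj : obj;

  space_hilbertian : forall A : obj, hilbertian (hspace A);
  mor_linear : forall A B (f : hspace A -> hspace B), mor f -> linear f;
  mor_continuous : forall A B (f : hspace A -> hspace B), mor f -> continuous f;
  mor_id : forall A : obj, mor (@id (hspace A));
  mor_comp : forall A B D (g : hspace B -> hspace D) (f : hspace A -> hspace B),
    mor g -> mor f -> mor (g \o f);

  zero_objP : forall x : hspace zero_obj, x = 0;
  biproduct : forall A B : obj, exists (S : obj)
    (i1 : hspace A -> hspace S) (i2 : hspace B -> hspace S)
    (p1 : hspace S -> hspace A) (p2 : hspace S -> hspace B),
    [/\ mor i1 /\ mor i2, mor p1 /\ mor p2,
        cancel i1 p1 /\ cancel i2 p2,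
        (forall y, p1 (i2 y) = 0) /\ (forall x, p2 (i1 x) = 0)
      & forall z, i1 (p1 z) + i2 (p2 z) = z];

  dualP : forall H : obj, is_antidual (@ev H);
  dual_iso : forall H : obj, exists (phi : hspace H -> hspace (dual H))
    (psi : hspace (dual H) -> hspace H) (ip : {dot (hspace H) for conjC}),
    [/\ mor phi, mor psi, cancel phi psi, cancel psi phi
      & admissible ip /\ forall x y, ip x y = ev (phi x) y];
  bidual : forall H : obj, exists2 c : hspace H -> hspace (dual (dual H)),
    mor c & forall h p, ev (c h) p = (ev p h)^*;
  dual_map : forall A B (f : hspace A -> hspace B), mor f ->
    exists2 fd : hspace (dual B) -> hspace (dual A),
      mor fd & forall p x, ev (fd p) x = ev p (f x);
  mor_kernel : forall A B (f : hspace A -> hspace B), mor f ->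
    exists (K : obj) (k : hspace K -> hspace A),
      mor k /\ subspace_inclusion k (f @^-1` [set 0]);
  mor0 : forall A B : obj, mor (fun _ : hspace A => 0 : hspace B);
  mor_lincomb : forall A B (a : R[i]) (f g : hspace A -> hspace B),
    mor f -> mor g -> mor (fun x => a *: f x + g x);
  (* weak operator topology *)
  mor_weakly_closed : forall A B (f : hspace A -> hspace B),
    linear f -> continuous f ->
    (forall (n : nat) (x : 'I_n -> hspace A) (p : 'I_n -> hspace (dual B))
       (e : R[i]), 0 < e ->
       exists2 g : hspace A -> hspace B, mor g &
         forall k, `|ev (p k) (f (x k) - g (x k))| < e) ->
    mor f
}.

Coercion hspace : obj >-> TopologicalLmodule.type.

Section VonNeumannCategory.
Context {R : realType} {C : hvn_category R}.
Implicit Types A B H I K Q : C.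

Definition C_admissible H (ip : {dot H for conjC}) : Prop :=
  admissible ip /\
  exists2 phi : H -> dual H, mor phi & forall x y, ip x y = ev (phi x) y.

(* Only the values on [mor H H] are meaningful. *)
Record trace := Trace {
  tr :> forall H : C, (H -> H) -> R[i];
  tr_linear : forall H (a : R[i]) (f g : H -> H), mor f -> mor g ->
    tr (fun x => a *: f x + g x) = a * tr f + tr g;
  tr_cyclic : forall A B (f : A -> B) (g : B -> A), mor f -> mor g ->
    tr (g \o f) = tr (f \o g)
}.

Implicit Type tau : trace.

(* [0 <= z] in [R[i]] means that [z] is real and nonnegative. *)
Definition trace_ge0 tau : Prop :=
  forall H (e : H -> H), mor e -> e \o e = e -> 0 <= tau H e.

(* Along every upward directed set of nonnegative operators with a least upper
   bound [T] in the von Neumann algebra [mor H H], the trace converges to the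
   trace of [T]. *)
Definition trace_normal tau : Prop :=
  forall H (ip : {dot H for conjC}), C_admissible ip ->
  forall (D : set (H -> H)) (T : H -> H),
    D !=set0 ->
    (forall S, D S -> mor S /\ op_ge0 ip S) ->
    (forall S1 S2, D S1 -> D S2 ->
       exists S, [/\ D S, op_le ip S1 S & op_le ip S2 S]) ->
    mor T ->
    (forall S, D S -> op_le ip S T) ->
    (forall U, mor U -> (forall S, D S -> op_le ip S U) -> op_le ip T U) ->
  forall e : R[i], 0 < e -> exists2 S, D S &
    forall S', D S' -> op_le ip S S' -> `|tau H T - tau H S'| < e.

Definition trace_faithful tau : Prop :=
  forall H (ip : {dot H for conjC}), C_admissible ip ->
  forall T : H -> H, mor T -> op_ge0 ip T -> tau H T = 0 -> T = fun=> 0.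

Definition is_kernel A B (f : A -> B) K (k : K -> A) : Prop :=
  mor k /\ subspace_inclusion k (f @^-1` [set 0]).

Definition is_closed_image A B (f : A -> B) I (i : I -> B) : Prop :=
  mor i /\ subspace_inclusion i (closure (range f)).

Definition is_coimage A B (f : A -> B) Q (q : A -> Q) : Prop :=
  mor q /\ quotient_projection q (f @^-1` [set 0]).

Record ext_obj := ExtObj {
  esrc : C;
  etgt : C;
  emap : esrc -> etgt;
  emap_hom : mor emap
}.

Implicit Types X Y : ext_obj.

(* [f] represents a morphism from [X] to [Y] of the extended category. *)
Definition ext_rep X Y (f : etgt X -> etgt Y) : Prop :=
  mor f /\ exists2 f' : esrc X -> esrc Y, mor f' &
    f \o @emap X = @emap Y \o f'.

(* [f1] and [f2] represent the same morphism from [X] to [Y]. *)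
Definition ext_eq X Y (f1 f2 : etgt X -> etgt Y) : Prop :=
  exists2 F : etgt X -> esrc Y, mor F & forall x, f1 x - f2 x = emap (F x).

Definition ext_iso X Y : Prop :=
  exists (f : etgt X -> etgt Y) (g : etgt Y -> etgt X),
    [/\ ext_rep f, ext_rep g, ext_eq (X := X) (Y := X) (g \o f) id
      & ext_eq (X := Y) (Y := Y) (f \o g) id].

Definition is_torsion X : Prop := dense (range (@emap X)).

(* The closure of the image is given by an object and an inclusion, so that [Y]
   is unique up to isomorphism only. *)
Definition is_torsion_part X Y : Prop :=
  exists (I : C) (i : I -> etgt X) (a : esrc X -> I) (ha : mor a),
    [/\ is_closed_image (@emap X) i, i \o a = @emap X & Y = ExtObj ha].

(* [T = (alpha^* alpha)^(1/2)] with spectral family [E], and [F l = tau (E l)].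
   The scalar products determine [T], [E] and [F], and the finiteness of the
   integral does not depend on them. There is no mass at [0], as [alpha] is
   injective. *)
Definition tau_isomorphism tau (A' A : C) (alpha : A' -> A) : Prop :=
  [/\ mor alpha, injective alpha, dense (range alpha)
    & exists (ip' : {dot A' for conjC}) (ip : {dot A for conjC})
        (T : A' -> A') (E : R -> A' -> A') (F : cumulative R R),
        [/\ C_admissible ip', C_admissible ip, is_modulus ip' ip alpha T,
            is_spectral_family ip' T E
          & (forall l, mor (E l) /\ tau A' (E l) = (F l)%:C%C) /\
            (-oo < \int[lebesgue_stieltjes_measure F]_(l in `]0%R, +oo[)
                     (ln l)%:E)%E]].

Definition tau_trivial tau X : Prop :=
  is_torsion X /\
  exists Y, ext_iso X Y /\ tau_isomorphism tau (@emap Y).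

End VonNeumannCategory.

Arguments trace {R} C.
Arguments ext_obj {R} C.

Section Complexes.
Context {R : realType} {C : hvn_category R}.

(* [bd i : C^i -> C^(i+1)]; see [cdiff] for the indexing by the target. *)
Record complex_in (n : nat) := ComplexIn {
  cob : nat -> C;
  bd : forall i : nat, cob i -> cob i.+1;
  bd_hom : forall i : nat, mor (@bd i);
  bd_bd : forall (i : nat) (x : cob i), bd (bd x) = 0;
  cob_zero : forall i : nat, (n < i)%N -> forall x : cob i, x = 0
}.

Variables (n : nat) (K : complex_in n).

(* [C^(i-1)], which is zero for [i = 0]. *)
Definition cob_pred (i : nat) : C :=
  if i is j.+1 then cob K j else zero_obj C.

(* The differential [C^(i-1) -> C^i], for all [i >= 0]. *)
Definition cdiff (i : nat) : cob_pred i -> cob K i :=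
  match i return cob_pred i -> cob K i with
  | 0%N => fun=> 0
  | j.+1 => @bd n K j
  end.

(* [X] is [cdiff i : C^(i-1) -> ker (cdiff i.+1)]. *)
Definition is_ext_cohomology (i : nat) (X : ext_obj C) : Prop :=
  exists (Z : C) (z : Z -> cob K i) (d : cob_pred i -> Z) (hd : mor d),
    [/\ is_kernel (@cdiff i.+1) z, z \o d = @cdiff i & X = ExtObj hd].

(* [Q] is [C^(j-1) / ker (cdiff j)], [I] is the closure of the image of
   [cdiff j], and [d : Q -> I] is the map induced by [cdiff j]. *)
Definition determinant_class (tau : trace C) : Prop :=
  forall j : nat, (1 <= j <= n)%N ->
    exists (Q I : C) (q : cob_pred j -> Q) (i : I -> cob K j) (d : Q -> I),
      [/\ is_coimage (@cdiff j) q, is_closed_image (@cdiff j) i,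
          i \o d \o q = @cdiff j & tau_isomorphism tau d].

End Complexes.

Arguments complex_in {R} C n.

(* Main.v *)
From HB Require Import structures.
Require Import Defs.
From mathcomp Require Import all_boot all_order all_algebra.
From mathcomp Require Import all_classical all_reals all_analysis.
From mathcomp Require Import complex measurable_realfun ring lra.

(** Write [f : A -> B] for a differential of the complex and [I] for the closure
    of its image. The torsion part of the extended cohomology is the corestriction
    [a : A -> I] of [f], and the determinant class condition concerns the induced
    map [d : A / ker f -> I]. Since the kernel is complemented in the category,
    the projection to the coimage has a section, and [a] and [d] are isomorphic
    objects of the extended category. This settles one direction: if [d] is a
    tau-isomorphism, the torsion part is tau-trivial.

    For the other direction, [d] is isomorphic in the extended category to some
    tau-isomorphism [be], and one has to conclude that [d] is itself a
    tau-isomorphism ([tau_isomorphism_transfer]). The isomorphism provides maps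
    of pairs [(f, f')] and [(g, g')] between [d] and [be], and a homotopy [F]
    with [g f - 1 = d F], hence [g' f' - 1 = F d] by injectivity of [d]. On the
    spectral subspace of [d] for a small parameter [l] the operator [F d] is
    small, so [f'] is bounded below there, and it sends this subspace into vectors
    on which [be] has norm of order [l]. Following [f'] by the spectral projection
    of [be] for the parameter [c l], with [c] fixed and large, remains bounded
    below. By cyclicity and nonnegativity of the trace ([trace_idem_le]) the
    spectral density function of [d] at [l] is at most that of [be] at [c l].
    Finally the integral of the logarithm differs from [-oo] exactly when the
    series of the values of the density function at [e^-k] converges, and this
    condition passes from [be] to [d] ([log_integral_compare]).

    To speak of the spectral density function of [d], its modulus and a spectral
    family must be constructed inside the category. Everything rests on the fact
    that strong limits of morphisms are morphisms ([mor_slim]). It gives inverses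
    of coercive morphisms ([coercive_inverse]), hence retractions of closed
    embeddings and orthogonal projections onto kernels, and square roots of
    positive morphisms as monotone limits of polynomials ([sqrt_one_minus]). The
    spectral projection of [T] at [l] is then the projection onto the kernel of
    [|T - l| + (T - l)] ([spectral_projection]), and normality of the trace makes
    the density function right continuous ([sproj_trace_cumulative]). *)

Set Implicit Arguments.
Unset Strict Implicit.
Unset Printing Implicit Defensive.

Import Order.TTheory GRing.Theory Num.Def Num.Theory.
Import numFieldNormedType.Exports.

Local Open Scope classical_set_scope.
Local Open Scope ring_scope.

(** * Linear maps and real inner products *)

Section LinearMaps.
Context {K : nzRingType} {U V W : lmodType K}.
Implicit Types (f : U -> V) (x y : U).

Lemma linD f : linear f -> forall x y, f (x + y) = f x + f y.
Proof. by move=> hf x y; rewrite -[x]scale1r hf !scale1r. Qed.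

Lemma lin0 f : linear f -> f 0 = 0.
Proof. by move=> hf; apply: (addIr (f 0)); rewrite -linD// !add0r. Qed.

Lemma linZ f : linear f -> forall a x, f (a *: x) = a *: f x.
Proof. by move=> hf a x; rewrite -[a *: x]addr0 hf (lin0 hf) addr0. Qed.

Lemma linB f : linear f -> forall x y, f (x - y) = f x - f y.
Proof. by move=> hf x y; rewrite -!scaleN1r addrC hf addrC. Qed.

Lemma linear_comp (g : V -> W) f : linear g -> linear f -> linear (g \o f).
Proof. by move=> hg hf a x y /=; rewrite hf hg. Qed.

End LinearMaps.

Section InnerProduct.
Context {R : realType} {H : topologicalLmodType R[i]} (ip : {dot H for conjC}).
Implicit Types x y z : H.

(** Inequalities only involve the underlying real Hilbert space. *)
Definition rip x y : R := complex.Re (ip x y).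
Definition rnorm x : R := Num.sqrt (rip x x).

Lemma ReD (a b : R[i]) : complex.Re (a + b) = complex.Re a + complex.Re b.
Proof. by case: a; case: b. Qed.

Lemma ReN (a : R[i]) : complex.Re (- a) = - complex.Re a.
Proof. by case: a. Qed.

Lemma ReB (a b : R[i]) : complex.Re (a - b) = complex.Re a - complex.Re b.
Proof. by rewrite ReD ReN. Qed.

Lemma ReZ (a : R) (b : R[i]) : complex.Re (a%:C%C * b) = a * complex.Re b.
Proof. by case: b => u v /=; rewrite mul0r subr0. Qed.

Lemma conj_complex (a : R[i]) : a^* = (a^*)%C.
Proof. by []. Qed.

Lemma ReJ (a : R[i]) : complex.Re (a^*) = complex.Re a.
Proof. by case: a. Qed.

Lemma ipC x y : ip x y = (ip y x)^*.
Proof. by rewrite (hermC ip) /= expr0 mul1r. Qed.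

Lemma ripC x y : rip x y = rip y x.
Proof. by rewrite /rip ipC ReJ. Qed.

Lemma ripDl x y z : rip (x + y) z = rip x z + rip y z.
Proof. by rewrite /rip linearDl ReD. Qed.

Lemma ripDr x y z : rip z (x + y) = rip z x + rip z y.
Proof. by rewrite !(ripC z) ripDl. Qed.

Lemma ripNl x z : rip (- x) z = - rip x z.
Proof. by rewrite /rip linearNl ReN. Qed.

Lemma ripNr x z : rip z (- x) = - rip z x.
Proof. by rewrite !(ripC z) ripNl. Qed.

Lemma ripZl (a : R) x z : rip (a%:C%C *: x) z = a * rip x z.
Proof. by rewrite /rip linearZl_LR /= ReZ. Qed.

Lemma ripZr (a : R) x z : rip z (a%:C%C *: x) = a * rip z x.
Proof. by rewrite !(ripC z) ripZl. Qed.

Lemma rip0l x : rip 0 x = 0.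
Proof. by rewrite /rip linear0l. Qed.

Lemma rip0r x : rip x 0 = 0.
Proof. by rewrite ripC rip0l. Qed.

Definition ripE := (ripDl, ripDr, ripNl, ripNr, ripZl, ripZr).

Lemma rip_complex x : ip x x = (rip x x)%:C%C.
Proof.
have := dnorm_ge0 ip x; rewrite /rip lecE.
by case: (ip x x) => a b /= /andP[/eqP -> _].
Qed.

Lemma rip_ge0 x : 0 <= rip x x.
Proof. by have := dnorm_ge0 ip x; rewrite rip_complex ler0c. Qed.

Lemma rip_eq0 x : rip x x = 0 -> x = 0.
Proof.
by move=> h; apply/eqP; rewrite -(dnorm_eq0 ip) rip_complex h.
Qed.

Lemma rnorm_ge0 x : 0 <= rnorm x.
Proof. exact: sqrtr_ge0. Qed.

Lemma rnorm_sq x : rnorm x ^+ 2 = rip x x.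
Proof. by rewrite sqr_sqrtr// rip_ge0. Qed.

Lemma rnorm0 : rnorm 0 = 0.
Proof. by rewrite /rnorm rip0l sqrtr0. Qed.

Lemma rnorm_eq0 x : rnorm x = 0 -> x = 0.
Proof. by move=> h; apply: rip_eq0; rewrite -rnorm_sq h expr0n. Qed.

Lemma rnormN x : rnorm (- x) = rnorm x.
Proof. by rewrite /rnorm ripNl ripNr opprK. Qed.

Lemma rnormBC x y : rnorm (x - y) = rnorm (y - x).
Proof. by rewrite -rnormN opprB. Qed.

Lemma rnormZ (a : R) x : rnorm (a%:C%C *: x) = `|a| * rnorm x.
Proof.
by rewrite /rnorm ripZl ripZr mulrA -expr2 sqrtrM ?sqr_ge0// sqrtr_sqr.
Qed.

(** Positivity of the form at [<y, y> x - <x, y> y]. *)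
Lemma rip_CS x y : rip x y ^+ 2 <= rip x x * rip y y.
Proof.
have [y0|y0] := eqVneq y 0.
  by rewrite y0 !rip0r expr0n mulr0.
have yy : 0 < rip y y.
  rewrite lt_def rip_ge0 andbT; apply: contra_neq y0; exact: rip_eq0.
suff : 0 <= rip y y * (rip x x * rip y y - rip x y ^+ 2).
  by rewrite pmulr_rge0// subr_ge0.
have := rip_ge0 ((rip y y)%:C%C *: x - (rip x y)%:C%C *: y).
by rewrite !ripE (ripC y x); lra.
Qed.

Lemma rip_le x y : `|rip x y| <= rnorm x * rnorm y.
Proof.
rewrite -ler_sqr ?nnegrE ?mulr_ge0 ?rnorm_ge0// exprMn !rnorm_sq.
by rewrite real_normK ?num_real// rip_CS.
Qed.

Lemma rnormD x y : rnorm (x + y) <= rnorm x + rnorm y.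
Proof.
rewrite -ler_sqr ?nnegrE ?addr_ge0 ?rnorm_ge0// sqrrD !rnorm_sq !ripE (ripC y x).
have := le_trans (ler_norm _) (rip_le x y).
lra.
Qed.

Lemma rnormB x y : rnorm (x - y) <= rnorm x + rnorm y.
Proof. by rewrite -(rnormN y) rnormD. Qed.

Lemma rnorm_distD z x y : rnorm (x - y) <= rnorm (x - z) + rnorm (z - y).
Proof. by apply: le_trans (rnormD _ _); rewrite addrA subrK. Qed.

Lemma hnormE x : hnorm ip x = (rnorm x)%:C%C.
Proof.
rewrite /hnorm rip_complex -(rnorm_sq x) rmorphXn /=.
by rewrite sqrCK// ler0c rnorm_ge0.
Qed.

Lemma rnorm_le_sq x y : rip x x <= rip y y -> rnorm x <= rnorm y.
Proof. by move=> h; rewrite ler_wsqrtr. Qed.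

Lemma rnorm_leP x a : 0 <= a -> (rnorm x <= a) = (rip x x <= a ^+ 2).
Proof. by move=> a0; rewrite -rnorm_sq ler_sqr// nnegrE rnorm_ge0. Qed.

Lemma gt0_complex (e : R[i]) : 0 < e -> exists2 r : R, 0 < r & e = r%:C%C.
Proof.
case: e => a b; rewrite ltcE /= => /andP[/eqP -> a0]; by exists a.
Qed.

Section Admissible.
Hypothesis hip : admissible ip.

Lemma adm_nbhs x (U : set H) : nbhs x U <->
  exists2 e : R, 0 < e & forall y, rnorm (y - x) < e -> U y.
Proof.
rewrite (hip.1 x U); split => [[e /gt0_complex[r r0 ->] h]|[r r0 h]].
  by exists r => // y yr; apply: h => /=; rewrite hnormE ltcR.
by exists r%:C%C; rewrite ?ltcR// => y /=; rewrite hnormE ltcR; exact: h.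
Qed.

Lemma adm_cvg (T : Type) (F : set_system T) (FF : Filter F) (f : T -> H) (l : H) :
  (f @ F --> l) <-> (fun t => rnorm (f t - l)) @ F --> (0 : R).
Proof.
split => [fl|fl].
  apply/cvgrPdist_lt => e e0; apply: (fl [set y | `|0 - rnorm (y - l)| < e]).
  by apply/adm_nbhs; exists e => // y; rewrite /= sub0r normrN ger0_norm ?rnorm_ge0.
move=> U /adm_nbhs[e e0 h].
move/cvgrPdist_lt : fl => /(_ e e0); apply: filterS => t.
by rewrite sub0r normrN ger0_norm ?rnorm_ge0//; exact: h.
Qed.

Lemma adm_complete (u : nat -> H) :
  (forall e : R, 0 < e -> exists N : nat, forall m n : nat,
     (N <= m)%N -> (N <= n)%N -> rnorm (u m - u n) < e) ->
  exists l : H, (fun n => rnorm (u n - l)) @ \oo --> (0 : R).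
Proof.
move=> h; have [|l ul] := hip.2 u; last by exists l; apply/adm_cvg.
move=> _ /gt0_complex[e e0 ->]; have [N hN] := h e e0; exists N => m n Nm Nn.
by rewrite hnormE ltcR hN.
Qed.

End Admissible.

(** Multiplication by the imaginary unit recovers the imaginary part, so that
    identities between complex forms can be checked on real parts. *)
Lemma rip_i x y : rip ('i%C *: x) y = - complex.Im (ip x y).
Proof.
rewrite /rip linearZl_LR /=; case: (ip x y) => a b /=; by rewrite mul0r mul1r sub0r.
Qed.

(** Polarization: the diagonal values at [x + y] and at [i x + y] being real
    yields the imaginary and the real part of the identity. *)
Lemma op_ge0_selfadj (T : H -> H) : linear T -> op_ge0 ip T ->
  is_hilbert_adjoint ip ip T T.
Proof.
move=> lT T0 x y.
have im0 z : complex.Im (ip (T z) z) = 0.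
  have := T0 z; rewrite linear0l lecE => /andP[/eqP /= h _]; exact: h.
have imsum u v : complex.Im (ip (T u) v) = - complex.Im (ip (T v) u).
  have := im0 (u + v); rewrite (linD lT) linearDl !linearDr /=.
  have ImD (a b : R[i]) : complex.Im (a + b) = complex.Im a + complex.Im b.
    by case: a; case: b.
  by rewrite !ImD !im0 add0r addr0 => /eqP; rewrite addr_eq0 => /eqP.
have resym u v : complex.Re (ip (T u) v) = complex.Re (ip (T v) u).
  have := imsum ('i%C *: u) v.
  rewrite (linZ lT) linearZl_LR linearZr_LR /= (_ : ('i%C)^* = - 'i%C :> R[i]); last first.
    by rewrite conj_complex; apply/eqP; rewrite eq_complex /= oppr0 !eqxx.
  case: (ip (T u) v) => a b; case: (ip (T v) u) => c d /=; lra.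
rewrite (ipC x); apply/eqP; rewrite eq_complex; apply/andP; split; apply/eqP.
  by rewrite ReJ -resym.
rewrite imsum; by case: (ip (T y) x).
Qed.

Lemma selfadj_rip (T : H -> H) x y : is_hilbert_adjoint ip ip T T ->
  rip (T x) y = rip x (T y).
Proof. by move=> h; rewrite /rip h. Qed.

Lemma selfadj_Im (T : H -> H) x : is_hilbert_adjoint ip ip T T ->
  complex.Im (ip (T x) x) = 0.
Proof.
move=> /(_ x x)/(congr1 (@complex.Im R)); rewrite [in RHS]ipC.
by case: (ip (T x) x) => a b /=; lra.
Qed.

(** The discriminant argument applies to the possibly degenerate form of a
    positive operator: where it degenerates, a large multiple of [y] would make
    it negative unless the mixed term vanishes. *)
Lemma pos_CS (T : H -> H) x y : linear T -> is_hilbert_adjoint ip ip T T ->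
  (forall z, 0 <= rip (T z) z) ->
  rip (T x) y ^+ 2 <= rip (T x) x * rip (T y) y.
Proof.
move=> lT sT T0.
have e (a b : R) : 0 <= a ^+ 2 * rip (T x) x + a * b * rip (T x) y *+ 2 + b ^+ 2 * rip (T y) y.
  have := T0 (a%:C%C *: x + b%:C%C *: y).
  rewrite (linD lT) !(linZ lT) !ripE (selfadj_rip y x sT) (ripC y (T x)).
  lra.
have [yy|yy] := ltP 0 (rip (T y) y).
  suff : 0 <= rip (T y) y * (rip (T x) x * rip (T y) y - rip (T x) y ^+ 2).
    by rewrite pmulr_rge0// subr_ge0.
  by have := e (rip (T y) y) (- rip (T x) y); lra.
have {}yy : rip (T y) y = 0 by apply/eqP; rewrite eq_le yy T0.
rewrite yy mulr0.
have := e (rip (T x) y) (- (rip (T x) x + 1)); rewrite yy.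
have := T0 x; set a := rip (T x) x; set b := rip (T x) y => a0 h.
suff : (a + 2) * b ^+ 2 <= 0 by rewrite pmulr_rle0// ltr_wpDl.
lra.
Qed.

(** The form Cauchy-Schwarz inequality at [x] and [T x] bounds the norm of a
    positive operator by its quadratic form; in particular its operator norm is
    at most [M]. *)
Lemma pos_op_norm (T : H -> H) (M : R) : linear T -> is_hilbert_adjoint ip ip T T ->
  (forall z, 0 <= rip (T z) z) -> 0 <= M -> (forall z, rip (T z) z <= M * rip z z) ->
  forall x, rip (T x) (T x) <= M * rip (T x) x.
Proof.
move=> lT sT T0 M0 TM x.
have := pos_CS x (T x) lT sT T0.
have := TM (T x); have := T0 x; have := rip_ge0 (T x).
set a := rip (T x) (T x); set b := rip (T x) x; set c := rip (T (T x)) _.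
move=> a0 b0 cM h.
have [->|an0] := eqVneq a 0; first by rewrite mulr_ge0.
have {}a0 : 0 < a by rewrite lt_def an0.
have : a ^+ 2 <= b * (M * a) by apply: le_trans h _; rewrite ler_wpM2l.
by rewrite expr2 mulrA ler_pM2r// mulrC.
Qed.

Lemma pos_op_eq0 (T : H -> H) x : linear T -> is_hilbert_adjoint ip ip T T ->
  (forall z, 0 <= rip (T z) z) -> rip (T x) x = 0 -> T x = 0.
Proof.
move=> lT sT T0 Tx; apply: rip_eq0; apply/eqP.
by rewrite -sqrf_eq0 eq_le sqr_ge0 andbT; have := pos_CS x (T x) lT sT T0; rewrite Tx mul0r.
Qed.

End InnerProduct.

Section Bounded.
Context {R : realType} {A B : topologicalLmodType R[i]}
  (ipA : {dot A for conjC}) (ipB : {dot B for conjC}).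
Hypotheses (hA : admissible ipA) (hB : admissible ipB).

Lemma lin_bounded (f : A -> B) : linear f -> continuous f ->
  exists2 M : R, 0 < M & forall x, rnorm ipB (f x) <= M * rnorm ipA x.
Proof.
move=> lf cf.
have /(cf 0) : nbhs (f 0) [set y | rnorm ipB y < 1].
  by apply/(adm_nbhs hB); exists 1 => // y; rewrite (lin0 lf) subr0.
move=> /(adm_nbhs hA)[e e0 h].
exists (2 / e); first by rewrite divr_gt0.
move=> x; have [x0|x0] := eqVneq (rnorm ipA x) 0.
  by rewrite (rnorm_eq0 x0) (lin0 lf) !rnorm0 mulr0.
have xp : 0 < rnorm ipA x by rewrite lt_def x0 rnorm_ge0.
set a : R := e / (2 * rnorm ipA x).
have a0 : 0 < a by rewrite divr_gt0// mulr_gt0.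
have : rnorm ipA (a%:C%C *: x - 0) < e.
  rewrite subr0 rnormZ gtr0_norm// (_ : a * _ = e / 2); first by lra.
  by rewrite /a; field.
move/h => /=; rewrite (linZ lf) rnormZ gtr0_norm// => /ltW.
rewrite -ler_pdivlMl// => /le_trans; apply.
by rewrite /a invf_div mulr1 mulrAC.
Qed.

Lemma bounded_lin_continuous (f : A -> B) (M : R) : linear f ->
  (forall x, rnorm ipB (f x) <= M * rnorm ipA x) -> continuous f.
Proof.
move=> lf fM x U /(adm_nbhs hB)[e e0 h].
apply/(adm_nbhs hA); exists (e / (`|M| + 1)).
  by rewrite divr_gt0// ltr_wpDl.
move=> y; rewrite ltr_pdivlMr ?ltr_wpDl// => yx; apply: h.
rewrite -(linB lf); apply: le_lt_trans (fM _) _; apply: le_lt_trans yx.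
by rewrite mulrC ler_wpM2l ?rnorm_ge0// (le_trans (ler_norm _))// lerDl.
Qed.

End Bounded.

(** * Limits of sequences *)

Section Limits.
Context {R : realType} {H : topologicalLmodType R[i]} (ip : {dot H for conjC}).
Implicit Types (u v : nat -> H) (l : H).

(** Convergence is phrased with real norms; for an admissible scalar product it
    is convergence in the topology of the space. *)
Definition rcvg u l : Prop := (fun n => rnorm ip (u n - l)) @ \oo --> (0 : R).

Lemma rnormZc (a : R[i]) (x : H) : rnorm ip (a *: x) = complex.Re `|a| * rnorm ip x.
Proof.
have an : `|a| = (complex.Re `|a|)%:C%C by rewrite normc_def.
have a0 : 0 <= complex.Re `|a| by have := normr_ge0 a; rewrite an ler0c.
by rewrite /rnorm /rip dnormZ {1}an -rmorphXn ReZ sqrtrM ?sqr_ge0// sqrtr_sqr ger0_norm//.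
Qed.

Lemma rcvg_le u l (M : R) (v : nat -> R) : (forall n, rnorm ip (u n - l) <= M * v n) ->
  v @ \oo --> (0 : R) -> rcvg u l.
Proof.
move=> h v0; apply: (@squeeze_cvgr _ _ _ _ (fun=> 0) (fun n => M * v n)).
- by near=> n; rewrite rnorm_ge0 h.
- exact: cvg_cst.
- by rewrite -(mulr0 M); apply: (cvgM (cvg_cst _)).
Unshelve. all: by end_near. Qed.

Lemma rcvg_cst l : rcvg (fun=> l) l.
Proof. by rewrite /rcvg subrr rnorm0; exact: cvg_cst. Qed.

Lemma rcvgD u v l m : rcvg u l -> rcvg v m -> rcvg (fun n => u n + v n) (l + m).
Proof.
move=> ul vm; apply: (@rcvg_le _ _ 1 (fun n => rnorm ip (u n - l) + rnorm ip (v n - m))).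
  by move=> n; rewrite mul1r opprD addrACA rnormD.
by rewrite -(addr0 0); apply: cvgD.
Qed.

Lemma rcvgZ u l (a : R[i]) : rcvg u l -> rcvg (fun n => a *: u n) (a *: l).
Proof.
move=> ul; apply: (rcvg_le (M := complex.Re `|a|) _ ul) => n.
by rewrite -scalerBr rnormZc.
Qed.

Lemma rcvgB u v l m : rcvg u l -> rcvg v m -> rcvg (fun n => u n - v n) (l - m).
Proof.
move=> ul vm; have := rcvgD ul (rcvgZ (-1) vm); rewrite scaleN1r.
by congr (rcvg _ _); apply/funext => n; rewrite scaleN1r.
Qed.

Lemma rcvg_unique u l m : rcvg u l -> rcvg u m -> l = m.
Proof.
move=> ul um; apply/eqP; rewrite -subr_eq0; apply/eqP; apply: (@rnorm_eq0 _ _ ip).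
have := rcvgB ul um; rewrite /rcvg.
rewrite (_ : (fun _ => _) = fun=> rnorm ip (l - m)).
  by move=> h; apply: (@cvg_unique _ (@norm_hausdorff _ R) _ _ _ _ (cvg_cst _) h).
by apply/funext => n; rewrite subrr sub0r rnormN.
Qed.

Lemma rip_cvg (T : Type) (F : set_system T) (FF : Filter F) (f : T -> H) l (y : H) :
  (fun t => rnorm ip (f t - l)) @ F --> (0 : R) ->
  (fun t => rip ip (f t) y) @ F --> rip ip l y.
Proof.
move=> ul; apply/subr_cvg0; apply/norm_cvg0P.
apply: (@squeeze_cvgr _ _ _ _ (fun=> 0) (fun t => rnorm ip (f t - l) * rnorm ip y)).
- by near=> n; rewrite /= -ripNl -ripDl normr_ge0 rip_le.
- exact: cvg_cst.
- by rewrite -(mul0r (rnorm ip y)); apply: (cvgM _ (cvg_cst _)).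
Unshelve. all: by end_near. Qed.

Lemma rcvg_rnorm_le u l (M : R) : rcvg u l -> (forall n, rnorm ip (u n) <= M) ->
  rnorm ip l <= M.
Proof.
move=> ul uM; apply/ler_addgt0Pr => e e0.
move/cvgrPdist_lt : ul => /(_ e e0)[N _ /(_ N (leqnn N))] /=.
rewrite sub0r normrN ger0_norm ?rnorm_ge0// => /ltW h.
rewrite -(subrK (u N) l) addrC; apply: le_trans (rnormD _ _ _) _.
by rewrite lerD// rnormBC.
Qed.

Lemma rcvg_shift u l : rcvg u l -> rcvg (fun n => u n.+1) l.
Proof. by move=> ul; rewrite /rcvg (cvg_shiftS (fun n => rnorm ip (u n - l))). Qed.

Lemma rcvg_shiftn n u l : rcvg u l -> rcvg (fun k => u (k + n)%N) l.
Proof.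
move=> ul; elim: n => [|n IH].
  by rewrite (_ : (fun k => _) = u)//; apply/funext => k; rewrite addn0.
rewrite (_ : (fun k => _) = fun k => u (k.+1 + n)%N); first exact: rcvg_shift IH.
by apply/funext => k; rewrite addnS addSn.
Qed.

Lemma geometric_cauchy u (a q : R) : 0 <= a -> 0 <= q < 1 ->
  (forall n, rnorm ip (u n.+1 - u n) <= a * q ^+ n) ->
  forall e : R, 0 < e -> exists N : nat, forall m n : nat,
     (N <= m)%N -> (N <= n)%N -> rnorm ip (u m - u n) < e.
Proof.
move=> a0 /andP[q0 q1] h.
have q1' : 0 < 1 - q by rewrite subr_gt0.
have hk n k : rnorm ip (u (n + k)%N - u n) <= a / (1 - q) * (q ^+ n - q ^+ (n + k)).
  elim: k => [|k IH]; first by rewrite addn0 !subrr rnorm0 mulr0.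
  rewrite addnS; apply: le_trans (rnorm_distD _ (u (n + k)%N) _ _) _.
  apply: le_trans (lerD (h _) IH) _.
  rewrite exprS le_eqVlt; apply/orP; left; apply/eqP.
  field; by rewrite gt_eqF.
have hk' n k : rnorm ip (u (n + k)%N - u n) <= a / (1 - q) * q ^+ n.
  apply: le_trans (hk n k) _; apply: ler_wpM2l.
    by rewrite divr_ge0// ltW.
  by rewrite gerBl exprn_ge0.
have lim0 : (fun n => a / (1 - q) * q ^+ n) @ \oo --> (0 : R).
  rewrite -(mulr0 (a / (1 - q))); apply: (cvgM (cvg_cst _)).
  by apply: cvg_expr; rewrite ger0_norm.
move=> e e0; have e2 : 0 < e / 2 by rewrite divr_gt0.
move/cvgrPdist_lt : lim0 => /(_ _ e2)[N _ hN].
have {}hN n k : (N <= n)%N -> rnorm ip (u (n + k)%N - u n) < e / 2.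
  move=> Nn; apply: le_lt_trans (hk' n k) _.
  by have := hN n Nn; rewrite /= sub0r normrN; apply: le_lt_trans; exact: ler_norm.
exists N => m n Nm Nn.
apply: le_lt_trans (rnorm_distD _ (u N) _ _) _.
rewrite (rnormBC _ (u N)) [e]splitr ltrD//.
  by rewrite -(subnKC Nm) hN.
by rewrite -(subnKC Nn) hN.
Qed.

End Limits.

Lemma rcvg_bounded {R : realType} {A B : topologicalLmodType R[i]}
    (ipA : {dot A for conjC}) (ipB : {dot B for conjC}) (f : A -> B) (M : R)
    (u : nat -> A) (l : A) : linear f ->
  (forall x, rnorm ipB (f x) <= M * rnorm ipA x) ->
  rcvg ipA u l -> rcvg ipB (fun n => f (u n)) (f l).
Proof.
move=> lf fM ul; apply: (rcvg_le (M := M) _ ul) => n.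
by rewrite -(linB lf) fM.
Qed.

(** * Adjoints, strong limits and inverses *)

Section Category.
Context {R : realType} {C : hvn_category R}.
Implicit Types A B H L : C.

Definition cip_spec H (ip : {dot H for conjC}) : Prop :=
  admissible ip /\ exists (phi : H -> dual H) (psi : dual H -> H),
    [/\ mor phi, mor psi, cancel phi psi, cancel psi phi
      & forall x y, ip x y = ev (phi x) y].

Lemma cip_ex H : exists ip : {dot H for conjC}, cip_spec ip.
Proof.
have [phi [psi [ip [h1 h2 h3 h4 [h5 h6]]]]] := dual_iso H.
by exists ip; split => //; exists phi, psi.
Qed.

(** A scalar product whose duality isomorphism is invertible in the category:
    adjoints for these scalar products are again morphisms. *)
Definition cip H : {dot H for conjC} := projT1 (cid (cip_ex H)).

Lemma cipP H : cip_spec (cip H).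
Proof. exact: (projT2 (cid (cip_ex H))). Qed.

Lemma cip_adm H : admissible (cip H).
Proof. exact: (cipP H).1. Qed.

Lemma cip_C_adm H : C_admissible (cip H).
Proof.
have [h [phi [psi [h1 h2 h3 h4 h5]]]] := cipP H.
by split => //; exists phi.
Qed.

Lemma cadjoint A B (f : A -> B) : mor f ->
  exists2 g : B -> A, mor g & is_hilbert_adjoint (cip A) (cip B) f g.
Proof.
move=> mf; have [_ [phiA [psiA [A1 A2 A3 A4 A5]]]] := cipP A.
have [_ [phiB [psiB [B1 B2 B3 B4 B5]]]] := cipP B.
have [fd mfd fdE] := dual_map mf.
exists (psiA \o (fd \o phiB)); first by do 2 apply: mor_comp => //.
by move=> x y; rewrite ipC B5 -fdE [RHS]ipC A5 /= A4.
Qed.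

Lemma morD A B (f g : A -> B) : mor f -> mor g -> mor (fun x => f x + g x).
Proof.
move=> mf mg; have := mor_lincomb 1 mf mg.
by congr mor; apply/funext => x; rewrite scale1r.
Qed.

Lemma morZ A B (a : R[i]) (f : A -> B) : mor f -> mor (fun x => a *: f x).
Proof.
move=> mf; have := mor_lincomb a mf (mor0 A B).
by congr mor; apply/funext => x; rewrite addr0.
Qed.

Lemma morB A B (f g : A -> B) : mor f -> mor g -> mor (fun x => f x - g x).
Proof.
move=> mf mg; have := mor_lincomb (-1) mg mf.
by congr mor; apply/funext => x; rewrite scaleN1r addrC.
Qed.

Lemma mor_bounded A B (ipA : {dot A for conjC}) (ipB : {dot B for conjC}) (f : A -> B) :
  admissible ipA -> admissible ipB -> mor f ->
  exists2 M : R, 0 < M & forall x, rnorm ipB (f x) <= M * rnorm ipA x.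
Proof.
move=> hA hB mf; apply: lin_bounded => //; [exact: mor_linear | exact: mor_continuous].
Qed.

(** Strong limits are weak limits. *)
Lemma mor_slim A B (ipA : {dot A for conjC}) (ipB : {dot B for conjC})
    (g : nat -> A -> B) (f : A -> B) (M : R) :
  admissible ipA -> admissible ipB -> (forall n, mor (g n)) ->
  (forall x, rcvg ipB (fun n => g n x) (f x)) ->
  (forall x, rnorm ipB (f x) <= M * rnorm ipA x) -> mor f.
Proof.
move=> hA hB mg gf fM.
have lf : linear f.
  move=> a x y; apply: (rcvg_unique (gf _)).
  rewrite (_ : (fun n => _) = fun n => a *: g n x + g n y).
    by apply: rcvgD => //; exact: rcvgZ.
  by apply/funext => n; rewrite (mor_linear (mg n)).
apply: mor_weakly_closed => //; first exact: bounded_lin_continuous fM.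
move=> m x p _ /gt0_complex[e e0 ->].
have [_ alc _ _ _] := dualP B.
have small (k : 'I_m) : \forall n \near \oo, `|ev (p k) (f (x k) - g n (x k))| < e%:C%C.
  have [al cal] := alc (p k).
  have ev0 : ev (p k) 0 = 0.
    have := al 1 0 0; rewrite scaler0 addr0 conjC1 mul1r => h.
    by apply: (addIr (ev (p k) 0)); rewrite -h add0r.
  have : nbhs (ev (p k) 0 : R[i]^o) [set z | `|z| < e%:C%C].
    rewrite ev0; apply/nbhs_ballP; exists e%:C%C; first by rewrite /= ltcR.
    by move=> z; rewrite -ball_normE /= sub0r normrN.
  move=> /(cal 0) /(adm_nbhs hB)[d d0 hd].
  move/cvgrPdist_lt : (gf (x k)) => /(_ d d0); apply: filterS => n.
  rewrite sub0r normrN ger0_norm ?rnorm_ge0// => hn; apply: hd.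
  by rewrite subr0 rnormBC.
have [N _ hN] := filter_forall _ small.
exists (g N) => // k; exact: (hN N (leqnn N) k).
Qed.

(** Lax-Milgram inside the category. The affine map [w |-> w + mu (y - S w)]
    contracts for small [mu], since
    [|x - mu S x|^2 <= (1 - 2 mu c + mu^2 M^2) |x|^2]; its fixed point is the
    preimage of [y]. The iterates are morphisms in [y], so the inverse is a
    strong limit of morphisms. *)
Lemma coercive_inverse A (ip : {dot A for conjC}) (S : A -> A) (c : R) :
  admissible ip -> mor S -> 0 < c ->
  (forall x, c * rip ip x x <= rip ip (S x) x) ->
  exists W : A -> A, [/\ mor W, cancel S W & cancel W S].
Proof.
move=> hA mS c0 coer; have lS := mor_linear mS.
have [M0 M00 SM0] := mor_bounded hA hA mS.
set M := M0 + c.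
have M_gt0 : 0 < M by rewrite addr_gt0.
have SM x : rnorm ip (S x) <= M * rnorm ip x.
  by apply: le_trans (SM0 x) _; rewrite ler_wpM2r ?rnorm_ge0// lerDl ltW.
(* This value minimizes [1 - 2 mu c + mu^2 M^2]; adding [c] to the bound on
   [S] keeps the minimum nonnegative even on the zero space. *)
set mu := c / M ^+ 2.
have mu0 : 0 < mu by rewrite divr_gt0 ?exprn_gt0.
set q := Num.sqrt (1 - c ^+ 2 / M ^+ 2).
have q2 : 0 <= 1 - c ^+ 2 / M ^+ 2.
  rewrite subr_ge0 ler_pdivrMr ?exprn_gt0// mul1r ler_sqr ?nnegrE// ?(ltW c0) ?(ltW M_gt0)//.
  by rewrite /M lerDr ltW.
have q01 : 0 <= q < 1.
  rewrite sqrtr_ge0 /= -[ltRHS]sqrtr1 ltr_sqrt// gtrBl divr_gt0 ?exprn_gt0//.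
have contr x : rnorm ip (x - mu%:C%C *: S x) <= q * rnorm ip x.
  rewrite rnorm_leP ?mulr_ge0 ?sqrtr_ge0 ?rnorm_ge0// exprMn rnorm_sq sqr_sqrtr//.
  have h1 := coer x.
  have h2 : rip ip (S x) (S x) <= M ^+ 2 * rip ip x x.
    by rewrite -!rnorm_sq -exprMn ler_sqr ?nnegrE ?mulr_ge0 ?rnorm_ge0 ?(ltW M_gt0).
  rewrite !ripE (ripC ip x).
  have h3 : mu * (c * rip ip x x) <= mu * rip ip (S x) x by rewrite ler_wpM2l ?(ltW mu0).
  have h4 : mu ^+ 2 * rip ip (S x) (S x) <= mu ^+ 2 * (M ^+ 2 * rip ip x x).
    by rewrite ler_wpM2l ?sqr_ge0.
  have e1 : mu ^+ 2 * (M ^+ 2 * rip ip x x) = mu * (c * rip ip x x).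
    by rewrite /mu; field; rewrite gt_eqF.
  have e2 : (1 - c ^+ 2 / M ^+ 2) * rip ip x x = rip ip x x - mu * (c * rip ip x x).
    by rewrite /mu; field; rewrite gt_eqF.
  rewrite e2; move: h4; rewrite e1; lra.
pose step y w := w + mu%:C%C *: (y - S w).
have stepB y w z : step y w - step y z = (w - z) - mu%:C%C *: S (w - z).
  rewrite /step (linB lS) -scaleNr opprD addrACA -scalerBr scaleNr -scalerN.
  by congr (_ + _ *: _); rewrite opprB [LHS]addrC opprB addrA subrK.
pose g n y := iter n (step y) 0.
have gc y n : rnorm ip (g n.+1 y - g n y) <= rnorm ip (g 1%N y) * q ^+ n.
  elim: n => [|n IH]; first by rewrite expr0 mulr1 subr0.
  rewrite [g _ _]/= -/(g n.+1 y) [g n.+1 y in X in _ - X]/= -/(g n y) stepB.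
  apply: le_trans (contr _) _; rewrite exprS mulrCA ler_wpM2l//.
  by case/andP: q01.
have /choice[W hW] : forall y, exists l, rcvg ip (fun n => g n y) l.
  move=> y; apply: (adm_complete hA); apply: geometric_cauchy (gc y) => //.
  exact: rnorm_ge0.
have SW y : S (W y) = y.
  have lim1 := rcvgB (rcvg_shift (hW y)) (hW y).
  have lim2 := rcvgZ mu%:C%C
    (rcvgB (rcvg_cst ip y) (rcvg_bounded lS SM (hW y))).
  move: lim1; rewrite subrr.
  have -> : (fun n => g n.+1 y - g n y) = (fun n => mu%:C%C *: (y - S (g n y))).
    by apply/funext => n; rewrite [g n.+1 y]/= -/(g n y) /step addrC addKr.
  move=> lim1; have /eqP := rcvg_unique lim2 lim1.
  rewrite scaler_eq0 => /orP[/eqP[] mu00|].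
    by rewrite mu00 ltxx in mu0.
  by rewrite subr_eq0 => /eqP.
have Sinj x y : S x = S y -> x = y.
  move=> Sxy; apply/eqP; rewrite -subr_eq0; apply/eqP; apply: (@rip_eq0 _ _ ip).
  apply/eqP; rewrite eq_le rip_ge0 andbT -(ler_pM2l c0) mulr0.
  by apply: le_trans (coer _) _; rewrite (linB lS) Sxy subrr rip0l.
have mg n : mor (g n).
  elim: n => [|n IH]; first exact: mor0.
  apply: morD => //; apply: morZ; apply: morB; [exact: mor_id | exact: mor_comp mS IH].
exists W; split => //; last by move=> x; apply: Sinj; rewrite SW.
apply: (mor_slim (M := c^-1) hA hA mg) => // y.
rewrite -ler_pdivrMl ?invr_gt0// invrK.
have [->|wy] := eqVneq (rnorm ip (W y)) 0; first by rewrite mulr0 rnorm_ge0.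
have {}wy : 0 < rnorm ip (W y) by rewrite lt_def wy rnorm_ge0.
rewrite -(ler_pM2r wy) -mulrA -expr2 rnorm_sq.
apply: le_trans (coer _) _; rewrite SW.
by apply: le_trans (ler_norm _) (rip_le _ _ _).
Qed.

End Category.

(** * Retractions and orthogonal projections *)

Section RealAdjoint.
Context {R : realType} {A B : topologicalLmodType R[i]}
  (ipA : {dot A for conjC}) (ipB : {dot B for conjC}).

(** The imaginary parts agree by the hypothesis at [i x]. *)
Lemma rip_adjoint (f : A -> B) (g : B -> A) : linear f ->
  (forall x y, rip ipB (f x) y = rip ipA x (g y)) -> is_hilbert_adjoint ipA ipB f g.
Proof.
move=> lf h x y; apply/eqP; rewrite eq_complex; apply/andP; split; apply/eqP.
  exact: h.
by apply: oppr_inj; rewrite -!rip_i -(linZ lf) h.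
Qed.

Lemma adjoint_rip (f : A -> B) (g : B -> A) : is_hilbert_adjoint ipA ipB f g ->
  forall x y, rip ipB (f x) y = rip ipA x (g y).
Proof. by move=> h x y; rewrite /rip h. Qed.

Lemma rip_ext (x y : A) : (forall z, rip ipA x z = rip ipA y z) -> x = y.
Proof.
move=> h; apply/eqP; rewrite -subr_eq0; apply/eqP; apply: (@rip_eq0 _ _ ipA).
by rewrite ripDl ripNl h subrr.
Qed.

(** The induced topology makes the unit ball of the subspace contain the trace
    of a small ball; homogeneity turns this into a norm estimate. *)
Lemma subspace_bounded_below (i : A -> B) (V : set B) :
  admissible ipA -> admissible ipB -> subspace_inclusion i V ->
  exists2 c : R, 0 < c & forall x, c * rnorm ipA x <= rnorm ipB (i x).
Proof.
move=> hA hB [li _ _ top].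
have /(top 0 _).1[W] : nbhs 0 [set x : A | rnorm ipA x < 1].
  by apply/(adm_nbhs hA); exists 1 => // y; rewrite subr0.
rewrite (lin0 li) => /(adm_nbhs hB)[e e0 hW] hU.
exists e => // x; rewrite leNgt; apply/negP => xe.
have nx : 0 < rnorm ipA x.
  rewrite lt_def rnorm_ge0 andbT; apply/eqP => nx; move: xe.
  by rewrite nx mulr0 ltNge rnorm_ge0.
have : rnorm ipA ((rnorm ipA x)^-1%:C%C *: x) < 1.
  apply: hU; apply: hW; rewrite subr0 (linZ li) rnormZ gtr0_norm ?invr_gt0//.
  by rewrite ltr_pdivrMl// mulrC.
by rewrite rnormZ gtr0_norm ?invr_gt0// mulVf ?ltxx// gt_eqF.
Qed.

End RealAdjoint.

Section Retractions.
Context {R : realType} {C : hvn_category R}.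
Implicit Types A B H L K : C.

(** The retraction is [(t^* t)^-1 t^*], the one whose idempotent is the
    orthogonal projection. *)
Lemma bounded_below_retraction L B (t : L -> B) (c : R) : mor t -> 0 < c ->
  (forall x, c * rnorm (cip L) x <= rnorm (cip B) (t x)) ->
  exists v : B -> L, [/\ mor v, cancel t v &
    forall x y, rip (cip B) (t (v x)) y = rip (cip B) x (t (v y))].
Proof.
move=> mt c0 tc; have [ts mts /adjoint_rip ats] := cadjoint mt.
have mS : mor (ts \o t) by exact: mor_comp.
have [||W [mW SW WS]] := coercive_inverse (cip_adm L) mS (c := c ^+ 2).
- by rewrite exprn_gt0.
- move=> x; rewrite ripC -ats -!rnorm_sq -exprMn ler_sqr ?nnegrE ?rnorm_ge0//.
  by rewrite mulr_ge0 ?rnorm_ge0// ltW.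
exists (W \o ts); split; [exact: mor_comp | by move=> x; rewrite -[RHS]SW |].
have half x y : rip (cip B) (t (W (ts x))) y = rip (cip B) (t (W (ts x))) (t (W (ts y))).
  by rewrite !ats -[ts (t _)]/((ts \o t) _) WS.
by move=> x y; rewrite /= half [RHS]ripC [RHS]half ripC.
Qed.

Lemma inclusion_retraction L B (i : L -> B) (V : set B) : mor i ->
  subspace_inclusion i V ->
  exists v : B -> L, [/\ mor v, cancel i v &
    forall x y, rip (cip B) (i (v x)) y = rip (cip B) x (i (v y))].
Proof.
move=> mi /(subspace_bounded_below (cip_adm L) (cip_adm B))[c c0 ic].
exact: bounded_below_retraction ic.
Qed.

Lemma kernel_projection A B (f : A -> B) : mor f ->
  exists E : A -> A, [/\ mor E, forall x, E (E x) = E x,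
    forall x y, rip (cip A) (E x) y = rip (cip A) x (E y),
    forall x, f (E x) = 0 & forall x, f x = 0 -> E x = x].
Proof.
move=> mf; have [K [k [mk kE]]] := mor_kernel mf.
have [v [mv kv sv]] := inclusion_retraction mk kE.
have [_ _ rk _] := kE.
exists (k \o v); split => //=.
- exact: mor_comp.
- by move=> x; rewrite kv.
- by move=> x; have : range k (k (v x)) by []; rewrite rk.
by move=> x fx; have : (f @^-1` [set 0]) x by []; rewrite -rk => -[y _ <-]; rewrite kv.
Qed.

End Retractions.

(** * Square roots of positive operators *)

Section MonotoneLimit.
Context {R : realType} {A : topologicalLmodType R[i]} (ip : {dot A for conjC}).

(** The quadratic forms converge, being monotone and bounded, and
    [pos_op_norm] bounds the norm of a difference by the increment of the
    form. *)
Lemma mono_slim (Y : nat -> A -> A) : admissible ip ->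
  (forall n, linear (Y n)) -> (forall n, is_hilbert_adjoint ip ip (Y n) (Y n)) ->
  (forall n m, (n <= m)%N -> forall x, 0 <= rip ip (Y m x - Y n x) x <= rip ip x x) ->
  forall x, exists l, rcvg ip (fun n => Y n x) l.
Proof.
move=> hA lY sY dY x; apply: (adm_complete hA) => e e0.
pose a n := rip ip (Y n x) x.
have nda : nondecreasing_seq a.
  move=> n m nm; have /andP[+ _] := dY n m nm x.
  by rewrite ripDl ripNl subr_ge0.
have cva : cvgn a.
  apply: nondecreasing_is_cvgn => //.
  exists (a 0%N + rip ip x x) => _ [n _ <-].
  have /andP[_] := dY 0%N n isT x.
  by rewrite ripDl ripNl lerBlDl.
have e2 : 0 < e ^+ 2 by rewrite exprn_gt0.
have bound n m : (n <= m)%N -> rnorm ip (Y m x - Y n x) ^+ 2 <= limn a - a n.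
  move=> nm; pose D z := Y m z - Y n z.
  have lD : linear D by move=> c z w; rewrite /D (lY m) (lY n) scalerBr opprD addrACA.
  have sD : is_hilbert_adjoint ip ip D D.
    by move=> z w; rewrite /D linearBl linearBr /= (sY m) (sY n).
  have h1 z : 0 <= rip ip (D z) z by have /andP[] := dY n m nm z.
  have h2 z : rip ip (D z) z <= 1 * rip ip z z by rewrite mul1r; have /andP[] := dY n m nm z.
  have := pos_op_norm lD sD h1 ler01 h2 x; rewrite mul1r rnorm_sq => /le_trans; apply.
  by rewrite /D ripDl ripNl lerD2r nondecreasing_cvgn_le.
move/cvgrPdist_lt : (cva) => /(_ _ e2)[N _ hN].
have {}bound n m : (N <= n)%N -> (n <= m)%N -> rnorm ip (Y m x - Y n x) < e.
  move=> Nn nm; rewrite -ltr_sqr ?nnegrE ?rnorm_ge0 ?(ltW e0)//.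
  apply: le_lt_trans (bound n m nm) _; apply: le_lt_trans (hN n Nn); exact: ler_norm.
exists N => m n Nm Nn; have [nm|/ltnW mn] := leqP n m; first exact: bound.
by rewrite rnormBC bound.
Qed.

End MonotoneLimit.

Section PositiveCone.
Context {R : realType} {C : hvn_category R} {A : C}.
Variable B : A -> A.
Hypothesis mB : mor B.
Local Notation ip := (cip A).
Local Notation "<< x , y >>" := (rip ip x y) (at level 0, format "<< x ,  y >>").
Hypothesis sB : forall x y, <<B x, y>> = <<x, B y>>.
Hypothesis B_ge0 : forall x, 0 <= <<B x, x>>.
Hypothesis B_le1 : forall x, <<B x, x>> <= <<x, x>>.

(** The polynomials in [B] with nonnegative coefficients, in Horner form. They
    are positive, as the powers of [B] are, and they commute with everything
    that commutes with [B]: enough functional calculus to take square roots. *)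
Inductive pc : (A -> A) -> Prop :=
| pc0 : pc (fun=> 0)
| pcS c f : 0 <= c -> pc f -> pc (fun x => c%:C%C *: x + B (f x)).

Let lB : linear B := mor_linear mB.

Lemma pc_ext f g : pc f -> f =1 g -> pc g.
Proof. by move=> pf /funext <-. Qed.

Lemma pc_mor f : pc f -> mor f.
Proof.
elim => [|c g c0 _ IH]; first exact: mor0.
by apply: morD; [apply/morZ/mor_id | exact: mor_comp IH].
Qed.

Lemma pc_comp1 f : pc f -> pc (B \o f).
Proof.
move=> pf; apply: (pc_ext (pcS (lexx 0) pf)) => x.
by rewrite /= scale0r add0r.
Qed.

Lemma pc_id : pc id.
Proof.
by apply: (pc_ext (pcS ler01 pc0)) => x; rewrite (lin0 lB) addr0 scale1r.
Qed.

Lemma pcD f g : pc f -> pc g -> pc (fun x => f x + g x).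
Proof.
move=> pf; elim: pf g => [g pg|c f' c0 pf IH g [|d g' d0 pg]].
- by apply: (pc_ext pg) => x; rewrite add0r.
- by apply: (pc_ext (pcS c0 pf)) => x; rewrite addr0.
apply: (pc_ext (pcS (addr_ge0 c0 d0) (IH _ pg))) => x.
by rewrite rmorphD scalerDl (linD lB) addrACA.
Qed.

Lemma pcZ a f : 0 <= a -> pc f -> pc (fun x => a%:C%C *: f x).
Proof.
move=> a0; elim => [|c g c0 _ IH].
  by apply: (pc_ext pc0) => x; rewrite scaler0.
apply: (pc_ext (pcS (mulr_ge0 a0 c0) IH)) => x.
by rewrite rmorphM -scalerA (linZ lB) -scalerDr.
Qed.

Lemma pc_comp f g : pc f -> pc g -> pc (f \o g).
Proof.
move=> pf pg; elim: pf => [|c f' c0 _ IH]; first exact: pc0.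
by apply: (pc_ext (pcD (pcZ c0 pg) (pc_comp1 IH))).
Qed.

Lemma pc_comm f (G : A -> A) : pc f -> linear G -> (forall x, G (B x) = B (G x)) ->
  forall x, G (f x) = f (G x).
Proof.
move=> pf lG GB; elim: pf => [|c g c0 _ IH] x; first exact: lin0.
by rewrite (linD lG) (linZ lG) GB IH.
Qed.

Lemma pc_sym f : pc f -> forall x y, <<f x, y>> = <<x, f y>>.
Proof.
elim => [|c g c0 pg IH] x y; first by rewrite rip0l rip0r.
rewrite ripDl ripDr ripZl ripZr sB IH; congr (_ + <<_, _>>).
by rewrite (pc_comm pg lB).
Qed.

Lemma iter_linear k : linear (iter k B).
Proof. by elim: k => [|k IH] a x y //=; rewrite IH lB. Qed.

Lemma iter_ge0 k x : 0 <= <<iter k B x, x>>.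
Proof.
elim/ltn_ind: k x => -[_ x|[_ x|k IH x]]; [exact: rip_ge0 | exact: B_ge0 |].
by rewrite iterS sB -/(iter _ _ _) iterSr; apply: IH.
Qed.

Lemma pc_ge0 f : pc f -> forall x, 0 <= <<f x, x>>.
Proof.
move=> pf x; rewrite -[f x]/(iter 0 B (f x)); move: (0%N) => k.
elim: pf k => [|c g c0 _ IH] k; first by rewrite (lin0 (iter_linear k)) rip0l.
rewrite (linD (iter_linear k)) (linZ (iter_linear k)) -iterSr ripDl ripZl.
by rewrite addr_ge0// mulr_ge0// iter_ge0.
Qed.

(** The iteration for the least solution of [Y = (B + Y ^ 2) / 2]. *)
Fixpoint sqrt_iter n : A -> A :=
  if n is m.+1 then fun x => (2^-1 : R)%:C%C *: (B x + sqrt_iter m (sqrt_iter m x))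
  else fun=> 0.
Local Notation Y := sqrt_iter.

Lemma half_ge0 : 0 <= 2^-1 :> R.
Proof. by rewrite invr_ge0. Qed.

Lemma sqrt_iter_pc n : pc (Y n).
Proof.
elim: n => [|n IH]; first exact: pc0.
by apply: (pcZ half_ge0); apply: pcD; [exact: (pc_comp1 pc_id) | exact: pc_comp].
Qed.

(** [Y'' - Y' = (d Y + Y' d) / 2] when [Y' = Y + d], so increments stay in the
    cone and the iteration is monotone. *)
Lemma sqrt_iter_diff n : exists2 d, pc d & forall x, Y n.+1 x = Y n x + d x.
Proof.
elim: n => [|n [d pd dE]].
  exists (Y 1%N) => [|x]; [exact: sqrt_iter_pc | by rewrite /= add0r].
exists (fun x => (2^-1 : R)%:C%C *: (d (Y n x) + Y n.+1 (d x))).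
  apply: (pcZ half_ge0); apply: pcD; first exact: pc_comp pd (sqrt_iter_pc n).
  exact: pc_comp (sqrt_iter_pc n.+1) pd.
move=> x; rewrite -[Y n.+2 x]/(_ *: (B x + Y n.+1 (Y n.+1 x))).
have -> : Y n.+1 (Y n.+1 x) = Y n (Y n x) + (d (Y n x) + Y n.+1 (d x)).
  rewrite [Y n.+1 x]dE (linD (mor_linear (pc_mor (sqrt_iter_pc n.+1)))).
  by rewrite [Y n.+1 (Y n x)]dE addrA.
rewrite -[Y n.+1 x]/((2^-1 : R)%:C%C *: (B x + Y n (Y n x))).
by rewrite -scalerDr addrA.
Qed.

Lemma sqrt_iter_mono n m : (n <= m)%N ->
  exists2 d, pc d & forall x, Y m x = Y n x + d x.
Proof.
move/subnKC <-; elim: (m - n)%N => [|k [d pd dE]].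
  by exists (fun=> 0) => [|x]; [exact: pc0 | rewrite addn0 addr0].
have [d' pd' dE'] := sqrt_iter_diff (n + k)%N.
exists (fun x => d x + d' x); first exact: pcD.
by move=> x; rewrite addnS dE' dE addrA.
Qed.

Lemma B_contr x : rnorm ip (B x) <= rnorm ip x.
Proof.
apply: rnorm_le_sq.
have B1 z : <<B z, z>> <= 1 * <<z, z>> by rewrite mul1r.
have := pos_op_norm lB (rip_adjoint lB sB) B_ge0 ler01 B1 x.
by rewrite mul1r => /le_trans; apply.
Qed.

Lemma sqrt_iter_contr n x : rnorm ip (Y n x) <= rnorm ip x.
Proof.
elim: n x => [|n IH] x; first by rewrite rnorm0 rnorm_ge0.
rewrite /= rnormZ ger0_norm ?half_ge0// ler_pdivrMl// mulr_natl mulr2n.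
apply: le_trans (rnormD _ _ _) _; apply: lerD; first exact: B_contr.
exact: le_trans (IH _) (IH _).
Qed.

(** Square root of [1 - B], as [1 - Y] where [Y = (B + Y ^ 2) / 2]. *)
Lemma sqrt_one_minus : exists X : A -> A, [/\ mor X,
  forall x y, <<X x, y>> = <<x, X y>>, forall x, 0 <= <<X x, x>>,
  forall x, X (X x) = x - B x &
  forall G : A -> A, mor G -> (forall x, G (B x) = B (G x)) ->
    forall x, G (X x) = X (G x)].
Proof.
have lY n : linear (Y n) by apply/mor_linear/pc_mor/sqrt_iter_pc.
have sY n : is_hilbert_adjoint ip ip (Y n) (Y n).
  by apply: rip_adjoint => //; exact/pc_sym/sqrt_iter_pc.
have /choice[Z ZE] : forall x, exists l, rcvg ip (fun n => Y n x) l.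
  apply: (mono_slim (cip_adm A)) => // n m nm x.
  have [d pd dE] := sqrt_iter_mono nm; rewrite dE [_ + d x]addrC addrK.
  rewrite (pc_ge0 pd)/=.
  have h : <<Y m x, x>> <= <<x, x>>.
    apply: le_trans (ler_norm _) _; apply: le_trans (rip_le _ _ _) _.
    by rewrite -rnorm_sq expr2 ler_wpM2r ?rnorm_ge0// sqrt_iter_contr.
  apply: le_trans h; rewrite dE ripDl lerDr; exact/pc_ge0/sqrt_iter_pc.
have Zc x : rnorm ip (Z x) <= rnorm ip x.
  by apply: rcvg_rnorm_le (ZE x) _ => n; exact: sqrt_iter_contr.
have mZ : mor Z.
  apply: (mor_slim (M := 1) (cip_adm A) (cip_adm A)) ZE _.
    by move=> n; exact/pc_mor/sqrt_iter_pc.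
  by move=> x; rewrite mul1r.
have lZ := mor_linear mZ.
have sZ x y : <<Z x, y>> = <<x, Z y>>.
  have h1 : (fun n => <<Y n x, y>>) @ \oo --> <<Z x, y>> by apply: rip_cvg; exact: ZE.
  have h2 : (fun n => <<Y n y, x>>) @ \oo --> <<Z y, x>> by apply: rip_cvg; exact: ZE.
  have e : (fun n => <<Y n x, y>>) = (fun n => <<Y n y, x>>).
    by apply/funext => n; rewrite (adjoint_rip (sY n)) ripC.
  rewrite [RHS]ripC; apply: (@cvg_unique _ (@norm_hausdorff _ R) _ _ _ _ h1).
  by rewrite e.
have ZZ x : Z x = (2^-1 : R)%:C%C *: (B x + Z (Z x)).
  apply: (rcvg_unique (rcvg_shift (ZE x))); rewrite /=.
  apply: rcvgZ; apply: rcvgD; first exact: rcvg_cst.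
  apply: (@rcvg_le _ _ _ _ _ 1
    (fun n => rnorm ip (Y n x - Z x) + rnorm ip (Y n (Z x) - Z (Z x)))).
    move=> n; rewrite mul1r; apply: le_trans (rnorm_distD _ (Y n (Z x)) _ _) _.
    by rewrite lerD2r -(linB (lY n)) sqrt_iter_contr.
  by rewrite -(addr0 0); apply: cvgD; exact: ZE.
exists (fun x => x - Z x); split.
- by apply: morB => //; exact: mor_id.
- by move=> x y; rewrite !ripE sZ.
- move=> x; rewrite !ripE subr_ge0 -rnorm_sq expr2.
  apply: le_trans (ler_norm _) _; apply: le_trans (rip_le _ _ _) _.
  by rewrite ler_wpM2r ?rnorm_ge0.
- move=> x; rewrite (linB lZ).
  have e : Z x + Z x = B x + Z (Z x).
    rewrite {1 2}ZZ -scalerDl -rmorphD -div1r -splitr rmorph1 scale1r //.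
  by rewrite opprB addrA addrAC -(addrA x) -opprD e opprD addrA subrK.
move=> G mG GB x; have lG := mor_linear mG.
rewrite (linB lG); congr (_ - _).
have [M _ GM] := mor_bounded (cip_adm A) (cip_adm A) mG.
apply: (rcvg_unique (rcvg_bounded lG GM (ZE x))).
rewrite (_ : (fun n => _) = fun n => Y n (G x)); first exact: ZE.
by apply/funext => n; rewrite (pc_comm (sqrt_iter_pc n)).
Qed.

End PositiveCone.

(** * Spectral projections *)

Section SpectralProjections.
Context {R : realType} {C : hvn_category R} {A : C}.
Local Notation ip := (cip A).
Local Notation "<< x , y >>" := (rip ip x y) (at level 0, format "<< x ,  y >>").

Definition rsym (T : A -> A) := forall x y, <<T x, y>> = <<x, T y>>.

(** Rescaling brings the operator below the identity, where
    [sqrt_one_minus] applies. *)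
Lemma positive_sqrt (S : A -> A) : mor S -> rsym S -> (forall x, 0 <= <<S x, x>>) ->
  exists X : A -> A, [/\ mor X, rsym X, forall x, 0 <= <<X x, x>>,
    forall x, X (X x) = S x &
    forall G : A -> A, mor G -> (forall x, G (S x) = S (G x)) ->
      forall x, G (X x) = X (G x)].
Proof.
move=> mS sS S0; have lS := mor_linear mS.
have [M M0 SM] := mor_bounded (cip_adm A) (cip_adm A) mS.
pose B x := x - M^-1%:C%C *: S x.
have iM0 : 0 < M^-1 by rewrite invr_gt0.
have mB : mor B by apply: morB; [exact: mor_id | exact: morZ].
have [|x|x|X [mX sX X0 XX XG]] := sqrt_one_minus mB.
- by move=> x y; rewrite /B !ripE sS.
- rewrite /B !ripE subr_ge0 ler_pdivrMl// -rnorm_sq expr2 mulrA.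
  apply: le_trans (ler_norm _) _; apply: le_trans (rip_le _ _ _) _.
  by rewrite ler_wpM2r ?rnorm_ge0.
- by rewrite /B !ripE gerBl mulr_ge0// ltW.
exists (fun x => (Num.sqrt M)%:C%C *: X x); split.
- exact: morZ.
- by move=> x y; rewrite !ripE sX.
- by move=> x; rewrite !ripE mulr_ge0 ?sqrtr_ge0.
- move=> x; rewrite (linZ (mor_linear mX)) scalerA -rmorphM -expr2 sqr_sqrtr ?(ltW M0)//.
  rewrite XX /B opprB addrC subrK scalerA -rmorphM divff ?gt_eqF// rmorph1 scale1r //.
move=> G mG GS x; rewrite (linZ (mor_linear mG)); congr (_ *: _).
apply: XG => // {}x; rewrite /B (linB (mor_linear mG)) (linZ (mor_linear mG)).
by rewrite GS.
Qed.

(** [E] is the projection onto the kernel of [|T - l| + (T - l)], twice the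
    positive part of [T - l]. The last two clauses characterize the projection
    of the spectral theorem: [T <= l] on its image, while [T > l] strictly at
    every nonzero vector of its kernel. Monotonicity, right continuity and the
    integral formula all follow from these clauses and commutation. *)
Lemma spectral_projection (T : A -> A) (l : R) : mor T -> rsym T ->
  exists E : A -> A, [/\ mor E /\ rsym E, forall x, E (E x) = E x,
    forall G : A -> A, mor G -> rsym G -> (forall x, G (T x) = T (G x)) ->
      forall x, G (E x) = E (G x),
    forall x, <<T (E x), E x>> <= l * <<E x, E x>> &
    forall x, E x = 0 -> <<T x, x>> <= l * <<x, x>> -> x = 0].
Proof.
move=> mT sT; have lT := mor_linear mT.
pose N x := T x - l%:C%C *: x.
have mN : mor N by apply: morB => //; apply: morZ; exact: mor_id.
have lN := mor_linear mN.
have sN x y : <<N x, y>> = <<x, N y>> by rewrite /N !ripE sT.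
have [|x y|x|W [mW sW W0 WW WG]] := @positive_sqrt (N \o N).
- exact: mor_comp.
- by rewrite /= !sN.
- by rewrite /= sN rip_ge0.
have lW := mor_linear mW.
have [E [mE EE sE PE EP]] := kernel_projection (morD mW mN).
exists E; split => //.
- move=> G mG sG GT; have lG := mor_linear mG.
  have GN x : G (N x) = N (G x) by rewrite /N (linB lG) (linZ lG) GT.
  have GW x : G (W x) = W (G x) by apply: WG => // y /=; rewrite !GN.
  have EGE x : E (G (E x)) = G (E x).
    by apply: EP; rewrite -GW -GN -(linD lG) PE (lin0 lG).
  move=> x; apply: (@rip_ext _ _ ip) => z.
  by rewrite -EGE sE sG sE EGE -sG -sE.
- move=> x; have := PE x => /eqP; rewrite addr_eq0 => /eqP WN.
  have := W0 (E x); rewrite WN /N !ripE; lra.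
move=> x Ex0 Tx.
have Nx : <<N x, x>> <= 0 by rewrite /N !ripE; lra.
have WN y : W (N y) = N (W y) by rewrite (WG N mN).
(* [(W + N) (W - N) = W^2 - N^2 = 0], so [W - N] maps into the image of [E]. *)
have EQ : E (W x - N x) = W x - N x.
  apply: EP; rewrite (linB lW) (linB lN) WW /= WN.
  by rewrite addrA subrK subrr.
have : <<W x - N x, x>> = 0 by rewrite -EQ sE Ex0 rip0r.
rewrite ripDl ripNl => /subr0_eq WxNx.
have Wx0 : <<W x, x>> = 0 by apply/eqP; rewrite eq_le W0 WxNx Nx.
have Wx : W x = 0 by apply: pos_op_eq0 Wx0 => //; exact: rip_adjoint.
have Nx0 : N x = 0.
  by apply: (@rip_eq0 _ _ ip); rewrite -sN -[N (N x)]/((N \o N) x) -WW Wx (lin0 lW) rip0l.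
by rewrite -Ex0 EP// Wx Nx0 addr0.
Qed.

End SpectralProjections.

Section SpectralFamily.
Context {R : realType} {C : hvn_category R} {A : C}.
Local Notation ip := (cip A).
Local Notation "<< x , y >>" := (rip ip x y) (at level 0, format "<< x ,  y >>").
Variables (T : A -> A).
Hypotheses (mT : mor T) (sT : rsym T) (T0 : forall x, 0 <= <<T x, x>>).

Definition sproj (l : R) : A -> A := projT1 (cid (spectral_projection l mT sT)).
Local Notation E := sproj.

Lemma sprojP l : [/\ mor (E l) /\ rsym (E l), forall x, E l (E l x) = E l x,
    forall G : A -> A, mor G -> rsym G -> (forall x, G (T x) = T (G x)) ->
      forall x, G (E l x) = E l (G x),
    forall x, <<T (E l x), E l x>> <= l * <<E l x, E l x>> &
    forall x, E l x = 0 -> <<T x, x>> <= l * <<x, x>> -> x = 0].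
Proof. exact: (projT2 (cid (spectral_projection l mT sT))). Qed.

Lemma sproj_mor l : mor (E l).
Proof. by have [[]] := sprojP l. Qed.

Lemma sproj_sym l : rsym (E l).
Proof. by have [[]] := sprojP l. Qed.

Lemma sproj_idem l x : E l (E l x) = E l x.
Proof. by have [] := sprojP l. Qed.

Lemma sproj_lin l : linear (E l).
Proof. exact: mor_linear (sproj_mor l). Qed.

Lemma sproj_le l x : <<T (E l x), E l x>> <= l * <<E l x, E l x>>.
Proof. by have [] := sprojP l. Qed.

Lemma sproj_gt l x : E l x = 0 -> <<T x, x>> <= l * <<x, x>> -> x = 0.
Proof. by have [_ _ _ _ /(_ x)] := sprojP l. Qed.

Lemma sproj_commT l x : T (E l x) = E l (T x).
Proof. by have [_ _ /(_ T mT sT (fun=> erefl))] := sprojP l. Qed.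

Lemma sproj_comm l m x : E l (E m x) = E m (E l x).
Proof.
have [_ _ h _ _] := sprojP m; apply: h; [exact: sproj_mor|exact: sproj_sym|].
by move=> y; rewrite sproj_commT.
Qed.

Lemma sproj_rip l x y : <<E l x, E l y>> = <<E l x, y>>.
Proof. by rewrite sproj_sym sproj_idem -sproj_sym. Qed.

Lemma sproj_ge l x : E l x = 0 -> l * <<x, x>> <= <<T x, x>>.
Proof.
move=> Ex; rewrite leNgt; apply/negP => h.
by have := h; rewrite (sproj_gt Ex (ltW h)) !rip0r mulr0 ltxx.
Qed.

(** On the part of the image of [E l] killed by [E m] one has both [T <= l] and
    [T > m], so it is zero. *)
Lemma sproj_mono l m x : l <= m -> E m (E l x) = E l x.
Proof.
move=> lm; pose y := E l x - E m (E l x).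
apply/esym/subr0_eq; rewrite -/y.
have Ey : E m y = 0 by rewrite /y (linB (sproj_lin m)) sproj_idem subrr.
have ly : E l y = y.
  by rewrite /y (linB (sproj_lin l)) (sproj_comm l m) sproj_idem.
apply: (sproj_gt Ey); rewrite -ly; apply: le_trans (sproj_le l y) _.
by rewrite ler_wpM2r// rip_ge0.
Qed.

Lemma sproj_lt0 l x : l < 0 -> E l x = 0.
Proof.
move=> l0; apply: (@rip_eq0 _ _ ip); apply/eqP; rewrite eq_le rip_ge0 andbT.
by rewrite -(ler_nM2l l0) mulr0; apply: le_trans (sproj_le l x).
Qed.

Lemma sproj_ge_bound M l x : (forall x, <<T x, x>> <= M * <<x, x>>) -> M <= l -> E l x = x.
Proof.
move=> TM Ml; apply/esym/subr0_eq; apply: (@sproj_gt l).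
  by rewrite (linB (sproj_lin l)) sproj_idem subrr.
apply: le_trans (TM _) _; by rewrite ler_wpM2r// rip_ge0.
Qed.

Lemma sproj_bound : exists2 M : R, 0 < M & forall x, <<T x, x>> <= M * <<x, x>>.
Proof.
have [M M0 TM] := mor_bounded (cip_adm A) (cip_adm A) mT.
exists M => // x; apply: le_trans (ler_norm _) _; apply: le_trans (rip_le _ _ _) _.
by rewrite -rnorm_sq expr2 mulrA ler_wpM2r ?rnorm_ge0.
Qed.

Lemma sproj_norm l x : rnorm ip (E l x) <= rnorm ip x.
Proof.
have : rnorm ip (E l x) ^+ 2 <= rnorm ip (E l x) * rnorm ip x.
  rewrite rnorm_sq sproj_rip; apply: le_trans (ler_norm _) _; exact: rip_le.
have [->|n0] := eqVneq (rnorm ip (E l x)) 0; first by rewrite rnorm_ge0.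
by rewrite expr2 ler_pM2l// lt_def n0 rnorm_ge0.
Qed.

Lemma sproj_diff l m x : l <= m ->
  <<E m x - E l x, E m x - E l x>> = <<E m x, x>> - <<E l x, x>>.
Proof.
move=> lm; rewrite !ripE !sproj_rip.
have -> : <<E m x, E l x>> = <<E l x, x>>.
  by rewrite ripC -(sproj_mono x lm) -sproj_sym sproj_idem (sproj_mono _ lm).
have -> : <<E l x, E m x>> = <<E l x, x>>.
  by rewrite -sproj_sym (sproj_mono _ lm).
lra.
Qed.

Lemma sproj_quad_mono l m x : l <= m -> <<E l x, x>> <= <<E m x, x>>.
Proof. by move=> lm; rewrite -subr_ge0 -sproj_diff// rip_ge0. Qed.

(** The projections decrease strongly to some limit; on the excess [z] of the
    limit over [E l x] one has [T <= l + 1/(n+1)] for all [n] and [E l z = 0],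
    so [z = 0]. *)
Lemma sproj_right_seq l x : rcvg ip (fun n => E (l + n.+1%:R^-1) x) (E l x).
Proof.
pose mu n := l + n.+1%:R^-1 : R.
have mule n m : (n <= m)%N -> mu m <= mu n.
  by move=> nm; rewrite lerD2l lef_pV2 ?posrE ?ltr0n// ler_nat.
have lmu n : l <= mu n by rewrite lerDl invr_ge0.
have /(_ x)[k hk] : forall x, exists k, rcvg ip (fun n => x - E (mu n) x) k.
  apply: (mono_slim (cip_adm A)).
  - move=> n; apply: mor_linear; apply: morB; [exact: mor_id | exact: sproj_mor].
  - move=> n; apply: rip_adjoint.
      apply: mor_linear; apply: morB; [exact: mor_id | exact: sproj_mor].
    by move=> u v; rewrite !ripE sproj_sym.
  move=> n m /mule nm y; rewrite opprB addrC addrA subrK.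
  rewrite ripDl ripNl subr_ge0 sproj_quad_mono//=.
  have h1 : 0 <= <<E (mu m) y, y>> by rewrite -sproj_rip rip_ge0.
  have h2 : <<E (mu n) y, y>> <= <<y, y>>.
    by rewrite -sproj_rip -!rnorm_sq ler_sqr ?nnegrE ?rnorm_ge0// sproj_norm.
  lra.
have {}hk : rcvg ip (fun n => E (mu n) x) (x - k).
  have := rcvgB (rcvg_cst ip x) hk; congr (rcvg _ _ _).
  by apply/funext => n; rewrite opprB addrC subrK.
set z := x - k - E l x.
have hz : rcvg ip (fun n => E (mu n) x - E l x) z by exact: rcvgB (rcvg_cst _ _).
have Elip m y : rnorm ip (E m y) <= 1 * rnorm ip y by rewrite mul1r sproj_norm.
have Elz : E l z = 0.
  apply: (rcvg_unique (rcvg_bounded (sproj_lin l) (Elip l) hz)).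
  rewrite (_ : (fun n => _) = fun=> 0); first exact: rcvg_cst.
  apply/funext => n; rewrite (linB (sproj_lin l)) sproj_idem sproj_comm.
  by rewrite sproj_mono// subrr.
have Emz n : E (mu n) z = z.
  rewrite /z (linB (sproj_lin _)) (sproj_mono _ (lmu n)); congr (_ - _).
  have hkn := rcvg_shiftn n hk.
  apply: (rcvg_unique (rcvg_bounded (sproj_lin (mu n)) (Elip (mu n)) hkn)).
  rewrite (_ : (fun k => _) = fun k => E (mu (k + n)%N) x)//.
  by apply/funext => i; rewrite sproj_mono// mule// leq_addl.
suff z0 : z = 0 by move: hk; rewrite (subr0_eq z0).
apply: (sproj_gt Elz); apply/ler_addgt0Pr => e e0.
have ze0 : 0 <= <<z, z>> / e by rewrite divr_ge0 ?rip_ge0// ltW.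
set n := Num.bound (<<z, z>> / e).
have := sproj_le (mu n) z; rewrite Emz => /le_trans; apply.
rewrite mulrDl lerD2l ler_pdivrMl ?ltr0n// -ler_pdivrMr//.
apply: le_trans (ltW (archi_boundP ze0)) _.
by rewrite ler_nat.
Qed.

Lemma sproj_right_continuous l x : E m x @[m --> l^'+] --> E l x.
Proof.
apply/(adm_cvg (cip_adm A)).
have := sproj_right_seq l x; rewrite /rcvg => /cvgrPdist_lt h.
apply/cvgrPdist_lt => e /h[N _ /(_ N (leqnn N))]; rewrite /= !sub0r !normrN.
rewrite ger0_norm ?rnorm_ge0// => hN.
near=> m; rewrite sub0r normrN ger0_norm ?rnorm_ge0//; apply: le_lt_trans hN.
have lm : l <= m by near: m; exact: nbhs_right_ge.
have mN : m <= l + N.+1%:R^-1.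
  by near: m; apply: nbhs_right_le; rewrite ltrDl invr_gt0 ltr0n.
apply: rnorm_le_sq; rewrite !sproj_diff//; last exact: le_trans mN.
by rewrite lerD2r sproj_quad_mono.
Unshelve. all: by end_near. Qed.

End SpectralFamily.

(** * The integral of the identity for a Stieltjes measure *)

Section StieltjesIntegrals.
Context {R : realType}.
Local Open Scope ereal_scope.

Lemma cumulative_ex (f : R -> R) : {homo f : x y / (x <= y)%R} ->
  (forall x, f @ x^'+ --> f x) -> exists F : cumulative R R, F = f :> (R -> R).
Proof.
move=> nd rc.
pose m := isCumulative.Build R _ R f nd rc.
by exists (HB.pack f m : cumulative R R).
Qed.

Variable F : cumulative R R.
Local Notation nu := (lebesgue_stieltjes_measure F).

Let ndF : {homo F : x y / (x <= y)%R} := cumulative_is_nondecreasing F.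

Lemma stieltjes_itvoc (a b : R) : (a <= b)%R -> nu `]a, b]%classic = (F b - F a)%:E.
Proof.
move=> ab; rewrite /lebesgue_stieltjes_measure /measure_extension/=.
by rewrite measurable_mu_extE/=; [rewrite wlength_itv_bnd | exact: is_ocitv].
Qed.

Lemma stieltjes_itvoy (M : R) : (forall l, (M <= l)%R -> F l = F M) ->
  nu `]M, +oo[%classic = 0.
Proof.
move=> FM; apply: measure_negligible; first exact: measurable_itv.
have -> : `]M, +oo[%classic = \bigcup_(k : nat) `]M, (M + k%:R)%R]%classic.
  apply/seteqP; split => x /=; rewrite in_itv/= ?andbT => Mx.
    exists (Num.bound (x - M)) => //=; rewrite in_itv/= Mx -lerBlDl/=.
    by rewrite ltW// archi_boundP// subr_ge0 ltW.
  by case: Mx => k _; rewrite /= in_itv/= => /andP[].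
apply: negligible_bigcup => k; exists `]M, (M + k%:R)%R]%classic; split => //.
rewrite -[LHS]/(nu _) stieltjes_itvoc ?lerDl//.
by rewrite FM ?lerDl// subrr.
Qed.

Local Notation I a b := (\int[nu]_(l in `]a, b]) l%:E).

Lemma stieltjes_id_bounds (a b : R) : (0 <= a <= b)%R ->
  (a * (F b - F a))%:E <= I a b <= (b * (F b - F a))%:E.
Proof.
move=> /andP[a0 ab]; have mab : measurable (`]a, b]%classic : set (measurableTypeR R)).
  exact: measurable_itv.
rewrite !EFinM -stieltjes_itvoc// -!integral_cst//; apply/andP; split.
  apply: ge0_le_integral => //.
  by move=> x /=; rewrite in_itv/= => /andP[/ltW ax _]; rewrite lee_fin.
apply: ge0_le_integral => //.
- by move=> x /=; rewrite in_itv/= => /andP[/ltW ax _]; rewrite lee_fin (le_trans a0).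
- by move=> x /=; rewrite in_itv/= => /andP[_ xb]; rewrite lee_fin.
Qed.

(** A function of the endpoint whose increments satisfy the same bounds as
    those of the integral differs from it by a constant: over a partition of
    mesh [M / n] the discrepancy is at most [M (F M - F 0) / n]. *)
Lemma stieltjes_id_integral (g : R -> R) (M : R) : (0 < M)%R ->
  (forall a b, (0 <= a <= b)%R ->
     (a * (F b - F a) <= g b - g a <= b * (F b - F a))%R) ->
  (forall l, (M <= l)%R -> F l = F M) ->
  \int[nu]_(l in `[0%R, +oo[) l%:E = (g M - g 0)%:E.
Proof.
move=> M0 hg FM.
have split1 : `[0%R, +oo[%classic = `[0%R, 0%R]%classic `|` `]0%R, M]%classic `|` `]M, +oo[%classic.
  by rewrite -itv_bndbnd_setU ?bnd_simp// -?itv_bndbnd_setU ?bnd_simp// ltW.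
rewrite split1 ge0_integral_setU//; last 3 first.
- by apply: measurableU; exact: measurable_itv.
- by rewrite -split1 => x /=; rewrite in_itv/= andbT lee_fin.
- apply/disj_setPS => x /= [+ ]; rewrite !in_itv/= andbT => h Mx; case: h.
    by move=> /andP[_ x0]; have := lt_le_trans Mx x0; rewrite ltNge ltW.
  by move=> /andP[_ xM]; have := lt_le_trans Mx xM; rewrite ltxx.
rewrite (null_set_integral _ _ (stieltjes_itvoy FM)) ?adde0//.
rewrite ge0_integral_setU//; last 2 first.
- move=> x /= [|]; rewrite in_itv/= lee_fin => /andP[]; [by [] | by move/ltW].
- apply/disj_setPS => x /= []; rewrite !in_itv/= => /andP[_ x0] /andP[x0' _].
  by have := lt_le_trans x0' x0; rewrite ltxx.
rewrite [X in X + _](_ : _ = 0) ?add0r; last first.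
  apply: integral0_eq => x /=; rewrite in_itv/= => /andP[x0 x0'].
  by congr EFin; apply/eqP; rewrite eq_le x0 x0'.
have Ifin a b : (0 <= a <= b)%R -> I a b \is a fin_num.
  move=> ab; have /andP[h1 h2] := stieltjes_id_bounds ab.
  by rewrite fin_numE; apply/andP; split; [rewrite -ltNye (lt_le_trans _ h1)// ltNyr
    | rewrite -ltey (le_lt_trans h2)// ltry].
pose i b := fine (I 0%R b).
have iB a b : (0 <= a <= b)%R -> (i b - i a = fine (I a b))%R.
  move=> /andP[a0 ab]; rewrite /i.
  have -> : I 0%R b = I 0%R a + I a b.
    rewrite -ge0_integral_setU//.
    - by rewrite -itv_bndbnd_setU ?bnd_simp.
    - by move=> x /= [|]; rewrite in_itv/= lee_fin => /andP[/ltW x0 _]//; exact: le_trans x0.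
    - apply/disj_setPS => x /= []; rewrite !in_itv/= => /andP[_ xa] /andP[ax _].
      by have := lt_le_trans ax xa; rewrite ltxx.
  by rewrite fineD ?Ifin ?lexx ?a0// addrAC subrr add0r.
pose h b := (g b - i b)%R.
have hB a b : (0 <= a <= b)%R -> (`|h b - h a| <= (b - a) * (F b - F a))%R.
  move=> ab; have /andP[h1 h2] := hg a b ab.
  have /andP[h3 h4] := stieltjes_id_bounds ab.
  have := iB a b ab.
  move: h3 h4; rewrite -{1 2}(fineK (Ifin _ _ ab)) !lee_fin => h3 h4 e.
  rewrite /h ler_norml; apply/andP; split; lra.
have hn (n : nat) : (`|h M - h 0| <= M / n.+1%:R * (F M - F 0))%R.
  pose t k := (k%:R * (M / n.+1%:R))%R.
  have t0 : (0 <= M / n.+1%:R)%R by rewrite divr_ge0// ltW.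
  have hk k : (`|h (t k) - h (t 0%N)| <= M / n.+1%:R * (F (t k) - F (t 0%N)))%R.
    elim: k => [|k IH]; first by rewrite !subrr normr0 mulr0.
    apply: le_trans (ler_distD (h (t k)) _ _) _.
    have tk : (0 <= t k <= t k.+1)%R.
      by rewrite /t mulr_ge0//= ler_wpM2r// ler_nat.
    have := hB _ _ tk; have -> : (t k.+1 - t k = M / n.+1%:R)%R.
      by rewrite /t -mulrBl -natrB// subSnn mul1r.
    by move: IH; rewrite !mulrBr => IH h1; have := lerD h1 IH; rewrite addrA subrK.
  have tn : t n.+1 = M by rewrite /t mulrC divfK// pnatr_eq0.
  by have := hk n.+1; rewrite tn /t mul0r.
have h0 : (h M = h 0)%R.
  apply/eqP; rewrite -subr_eq0 -normr_le0; apply/ler_addgt0Pr => e e0.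
  rewrite add0r; set c := (M * (F M - F 0))%R.
  have c0 : (0 <= c / e)%R.
    by rewrite divr_ge0 ?(ltW e0)// mulr_ge0 ?(ltW M0)// subr_ge0 ndF ?(ltW M0).
  apply: le_trans (hn (Num.bound (c / e)%R)) _.
  rewrite mulrAC -/c ler_pdivrMr ?ltr0n// mulrC -ler_pdivrMr//.
  by apply: le_trans (ltW (archi_boundP c0)) _; rewrite ler_nat.
rewrite -[LHS]fineK; last by rewrite Ifin// lexx ltW.
congr EFin; rewrite -/(i M).
have i0 : i 0%R = 0%R by rewrite /i set_itvoc0 integral_set0.
by move: h0; rewrite /h i0; lra.
Qed.

End StieltjesIntegrals.

(** * Integrability of the logarithm *)

Section LogIntegral.
Context {R : realType}.
Local Open Scope ereal_scope.

Local Notation D := (`]0%R, +oo[%classic : set (measurableTypeR R)).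
Local Notation lnE := (fun l : measurableTypeR R => (ln (l : R))%:E).

Definition exp_ind (k : nat) (l : measurableTypeR R) : R :=
  \1_(`]0%R, expR (- k%:R)]%classic : set R) l.

(** For [0 < l] this counts the naturals [k <= - ln l], so that it exceeds the
    negative part of the logarithm by at most one; integrated term by term, it
    gives a series of masses of intervals. *)
Definition exp_count (l : measurableTypeR R) : \bar R :=
  \sum_(0 <= k <oo) (exp_ind k l)%:E.

Lemma exp_indE k l : (0 < l)%R -> exp_ind k l = ((k%:R <= - ln l)%R : nat)%:R.
Proof.
move=> l0; rewrite /exp_ind indicE mem_setE in_itv/= l0/=.
by rewrite -{1}(lnK l0) ler_expR lerNr.
Qed.

Lemma exp_ind_ge0 k l : (0 <= (exp_ind k l)%:E).
Proof. by rewrite lee_fin /exp_ind indicE. Qed.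

Lemma exp_count_ge0 l : 0 <= exp_count l.
Proof. by apply: nneseries_ge0 => k _ _; exact: exp_ind_ge0. Qed.

Lemma exp_partial_ge l m : (0 < l)%R ->
  (m%:R <= \sum_(0 <= k < m) exp_ind k l)%R \/
  (- ln l <= \sum_(0 <= k < m) exp_ind k l)%R.
Proof.
move=> l0; elim: m => [|m IH]; first by left; rewrite big_nil.
rewrite big_nat_recr//= exp_indE//; case: (leP (m%:R : R) (- ln l)%R) => h.
  by case: IH => IH; [left; rewrite -natr1 lerD2r | right; rewrite (le_trans IH)// lerDl].
rewrite addr0; right; case: IH => // IH; exact: le_trans (ltW h) IH.
Qed.

Lemma exp_partial_le l m : (0 < l <= 1)%R ->
  (\sum_(0 <= k < m) exp_ind k l <= - ln l + 1)%R.
Proof.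
move=> /andP[l0 l1]; have ln0 : (0 <= - ln l)%R by rewrite oppr_ge0 ln_le0.
elim: m => [|m IH]; first by rewrite big_nil addr_ge0.
rewrite big_nat_recr//= exp_indE//.
have hm : (\sum_(0 <= k < m) exp_ind k l <= m%:R)%R.
  elim: m {IH} => [|m IH]; first by rewrite big_nil lexx.
  by rewrite big_nat_recr//= -natr1 lerD// exp_indE// (ler_nat _ _ 1) leq_b1.
case: (leP (m%:R : R) (- ln l)%R) => hl; last by rewrite addr0 IH.
by rewrite lerD2r (le_trans hm).
Qed.

Lemma exp_count_ge l : (0 < l)%R -> lnE^\- l <= exp_count l.
Proof.
move=> l0; rewrite funenegE ge_max exp_count_ge0 andbT.
have h := exp_partial_ge (Num.bound `|- ln l|%R) l0.
apply: (@le_trans _ _ (\sum_(0 <= k < Num.bound `|- ln l|%R) (exp_ind k l)%:E)); last first.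
  by apply: nneseries_lim_ge => k _ _; exact: exp_ind_ge0.
rewrite sumEFin -EFinN lee_fin; case: h => // h.
by apply: le_trans h; apply: le_trans (ler_norm _) _; exact/ltW/archi_boundP.
Qed.

Lemma exp_count_le l : (0 < l)%R -> exp_count l <= lnE^\- l + (exp_ind 0 l)%:E.
Proof.
move=> l0; apply: lime_le.
  by apply: is_cvg_nneseries => k _ _; exact: exp_ind_ge0.
apply: nearW => m; rewrite sumEFin.
have n0 : 0 <= lnE^\- l by exact: funeneg_ge0.
case: (leP l 1%R) => l1.
  have -> : exp_ind 0 l = 1%R.
    by rewrite exp_indE// oppr_ge0 ln_le0.
  apply: (@le_trans _ _ (- ln l + 1)%:E); first by rewrite lee_fin exp_partial_le// l0.
  by rewrite EFinD leeD2r// funenegE le_max lexx.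
rewrite big1 ?adde_ge0 ?exp_ind_ge0// => k _; rewrite exp_indE// leNgt.
have -> // : (- ln l < k%:R)%R.
by apply: (@lt_le_trans _ _ 0%R) => //; rewrite oppr_lt0 ln_gt0.
Qed.

Lemma measurable_exp_ind k : measurable_fun D (fun l => (exp_ind k l)%:E).
Proof.
apply/measurable_EFinP; apply: measurable_funTS; apply: measurable_indic.
exact: measurable_itv.
Qed.

Lemma measurable_lnE : measurable_fun D lnE.
Proof. by apply/measurable_EFinP; apply: measurable_funTS; exact: measurable_ln. Qed.

Lemma exp_count_integral (F : cumulative R R) :
  \int[lebesgue_stieltjes_measure F]_(l in D) exp_count l =
  \sum_(0 <= k <oo) (F (expR (- k%:R)) - F 0)%:E.
Proof.
have mD : measurable D by exact: measurable_itv.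
have pos k (l : measurableTypeR R) : D l -> 0 <= (exp_ind k l)%:E.
  by move=> _; exact: exp_ind_ge0.
rewrite (integral_nneseries _ mD measurable_exp_ind pos).
apply: eq_eseriesr => k _; rewrite integral_indic//.
rewrite setIidl; first exact: stieltjes_itvoc (expR_ge0 _).
by move=> l /=; rewrite !in_itv/= andbT => /andP[].
Qed.

Lemma log_integral_neg (F : cumulative R R) :
  -oo < \int[lebesgue_stieltjes_measure F]_(l in D) (ln l)%:E <->
  \int[lebesgue_stieltjes_measure F]_(l in D) lnE^\- l < +oo.
Proof.
rewrite integralE; set a := integral _ _ _; set b := integral _ _ _.
have a0 : 0 <= a by apply: integral_ge0 => l _; exact: funepos_ge0.
have b0 : 0 <= b by apply: integral_ge0 => l _; exact: funeneg_ge0.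
rewrite ltNye ltey adde_eq_ninfty negb_or eqe_oppLR /=.
have -> // : a != -oo by rewrite -ltNye (lt_le_trans _ a0).
Qed.

(** Summation by parts in discrete form. The value [-oo] of the integral is
    only produced by an infinite negative part, because [+oo - oo = -oo]; and
    the negative part of the logarithm differs from [exp_count] by at most the
    indicator of the interval from 0 to 1, which has finite mass. *)
Lemma log_integral_series (F : cumulative R R) :
  -oo < \int[lebesgue_stieltjes_measure F]_(l in D) (ln l)%:E <->
  \sum_(0 <= k <oo) (F (expR (- k%:R)) - F 0)%:E < +oo.
Proof.
have pos l : D l -> (0 < l)%R by rewrite /= in_itv/= andbT.
have n0 l : 0 <= lnE^\- l by exact: funeneg_ge0.
have mcount : measurable_fun D exp_count.
  apply: (@ge0_emeasurable_sum _ _ _ D (fun k l => (exp_ind k l)%:E) xpredT).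
    by move=> k l _ _; exact: exp_ind_ge0.
  by move=> k _; exact: measurable_exp_ind.
have mneg : measurable_fun D lnE^\- by apply: measurable_funeneg; exact: measurable_lnE.
have mD : measurable D by exact: measurable_itv.
rewrite log_integral_neg -exp_count_integral; split => h.
  apply: (@le_lt_trans _ _ (\int[lebesgue_stieltjes_measure F]_(l in D)
      (lnE^\- l + (exp_ind 0 l)%:E))).
    apply: ge0_le_integral => //.
    - by move=> l _; exact: exp_count_ge0.
    - by apply: emeasurable_funD => //; exact: measurable_exp_ind.
    - by move=> l /pos; exact: exp_count_le.
  rewrite ge0_integralD//; last 2 first.
  - by move=> l _; exact: exp_ind_ge0.
  - exact: measurable_exp_ind.
  apply: lte_add_pinfty => //.
  rewrite integral_indic//.
  rewrite setIidl.
    have /eqP e := stieltjes_itvoc F (expR_ge0 (- 0%:R)).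
    by apply: le_lt_trans (ltry _); rewrite le_eqVlt; apply/orP; left; exact: e.
  by move=> l /=; rewrite !in_itv/= andbT => /andP[].
apply: le_lt_trans h; apply: ge0_le_integral => //.
by move=> l /pos; exact: exp_count_ge.
Qed.

(** Comparison near the origin up to a rescaling shifts the series of masses by
    a fixed number [m] of terms. *)
Lemma log_integral_compare (F G : cumulative R R) (c l0 : R) :
  (0 < c)%R -> (0 < l0)%R -> G 0%R = 0%R -> (0 <= F 0)%R ->
  (forall l, (0 < l <= l0)%R -> (F l <= G (c * l))%R) ->
  -oo < \int[lebesgue_stieltjes_measure G]_(l in D) (ln l)%:E ->
  -oo < \int[lebesgue_stieltjes_measure F]_(l in D) (ln l)%:E.
Proof.
move=> c0 l00 G0 F0 FG /log_integral_series hG; apply/log_integral_series.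
pose m := Num.bound (`|ln c| + `|ln l0|)%R.
have hm : (`|ln c| + `|ln l0| <= m%:R)%R by apply/ltW/archi_boundP; rewrite addr_ge0.
have ndF := cumulative_is_nondecreasing F.
have ndG := cumulative_is_nondecreasing G.
have t0 k : 0 <= (F (expR (- k%:R)) - F 0)%:E.
  by rewrite lee_fin subr_ge0 ndF// expR_ge0.
rewrite (nneseries_split 0 m)// add0n; apply: lte_add_pinfty.
  by rewrite sumEFin ltry.
rewrite -nneseries_addn//; apply: le_lt_trans hG.
apply: lee_nneseries => [k _ _|k _]; first exact: t0.
rewrite lee_fin G0 subr0; apply: (@le_trans _ _ (F (expR (- (k + m)%:R)))).
  by rewrite gerBl.
have kx : (expR (- (k + m)%:R) <= l0)%R.
  rewrite -[leRHS](lnK l00) ler_expR lerNl.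
  apply: (@le_trans _ _ m%:R); last by rewrite ler_nat leq_addl.
  apply: le_trans hm; apply: (@le_trans _ _ `|ln l0|%R); last by rewrite lerDr.
  by rewrite -normrN ler_norm.
apply: le_trans (FG _ _) _; first by rewrite expR_gt0.
apply: ndG; rewrite -[X in (X * _)%R](lnK c0) -expRD ler_expR natrD.
have := ler_norm (ln c); have := normr_ge0 (ln l0); move: hm; lra.
Qed.

End LogIntegral.

(** * Spectral families and traces *)

Section SpectralFamilyAxioms.
Context {R : realType} {C : hvn_category R} {A : C}.
Local Notation ip := (cip A).
Local Notation "<< x , y >>" := (rip ip x y) (at level 0, format "<< x ,  y >>").
Variables (T : A -> A).
Hypotheses (mT : mor T) (sT : rsym T) (T0 : forall x, 0 <= <<T x, x>>).
Local Notation E := (sproj mT sT).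

Lemma sproj_quad_right_continuous (l : R) x :
  <<E m x, x>> @[m --> l^'+] --> <<E l x, x>>.
Proof.
apply: rip_cvg; apply/(adm_cvg (cip_adm A)).
exact: sproj_right_continuous.
Qed.

(** The image of [E b - E a] lies in the image of [E b] and in the kernel of
    [E a], so [a <= T <= b] there. *)
Lemma sproj_increment (a b : R) x : a <= b ->
  a * (<<E b x, x>> - <<E a x, x>>) <= <<T (E b x), x>> - <<T (E a x), x>>
    <= b * (<<E b x, x>> - <<E a x, x>>).
Proof.
move=> ab; rewrite -sproj_diff//; set y := E b x - E a x.
have lT := mor_linear mT.
have lE l := mor_linear (sproj_mor mT sT l).
have Eby : E b y = y by rewrite /y (linB (lE b)) sproj_idem sproj_mono.
have Eay : E a y = 0.
  by rewrite /y (linB (lE a)) (sproj_comm _ _ a b) sproj_idem sproj_mono// subrr.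
have -> : <<T (E b x), x>> - <<T (E a x), x>> = <<T y, y>>.
  rewrite -ripNl -ripDl -(linB lT) -/y.
  have -> : <<T y, y>> = <<T y, E b x>> - <<T y, E a x>> by rewrite -ripNr -ripDr.
  by rewrite -!sproj_sym -!sproj_commT Eby Eay (lin0 lT) rip0l subr0.
by rewrite sproj_ge//= -{1 2}Eby -{3 4}Eby sproj_le.
Qed.

(** The increments of the form of [T] along the resolution satisfy the bounds
    of [stieltjes_id_integral], which yields the integral formula. *)
Lemma sproj_spectral_family : is_spectral_family ip T E.
Proof.
have [M M0 TM] := sproj_bound mT.
have lT := mor_linear mT.
split.
- move=> l; split; first by apply/funext => x; exact: sproj_idem.
  apply: rip_adjoint; [exact: sproj_lin | exact: sproj_sym].
- move=> l m lm; split; apply/funext => x /=; last exact: sproj_mono.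
  by rewrite sproj_comm sproj_mono.
- by move=> l x; exact: sproj_right_continuous.
- split; first by move=> l l0; apply/funext => x; exact: sproj_lt0.
  move=> x; apply/(adm_cvg (cip_adm A)); apply: cvg_near_cst.
  near=> l; have Ml : M <= l by near: l; apply: nbhs_pinfty_ge; exact: num_real.
  by rewrite (sproj_ge_bound _ _ _ TM Ml) subrr rnorm0.
move=> x; have [F FE] : exists F : cumulative R R, F = (fun l => <<E l x, x>>) :> (R -> R).
  apply: cumulative_ex.
    by move=> l m lm; exact: sproj_quad_mono.
  by move=> l; exact: sproj_quad_right_continuous.
exists F; split.
  move=> l; rewrite FE.
  have e : ip (E l x) x = ip (E l x) (E l x).
    rewrite -{1}(sproj_idem mT sT l x).
    exact: (rip_adjoint (sproj_lin mT sT l) (sproj_sym mT sT l)).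
  by rewrite /rip e; exact: rip_complex.
rewrite (@stieltjes_id_integral _ _ (fun a => <<T (E a x), x>>) M)//; last 2 first.
- by move=> a b /andP[_ ab]; rewrite FE sproj_increment.
- by move=> l Ml; rewrite FE !(sproj_ge_bound _ _ _ TM).
congr EFin; rewrite (sproj_ge_bound _ _ _ TM)//.
suff -> : <<T (E 0 x), x>> = 0 by rewrite subr0.
have -> : <<T (E 0 x), x>> = <<T (E 0 x), E 0 x>>.
  by rewrite -sproj_sym -sproj_commT sproj_idem.
by apply/eqP; rewrite eq_le T0 andbT -[leRHS](mul0r <<E 0 x, E 0 x>>) sproj_le.
Unshelve. all: end_near. Qed.

Lemma sproj_norm_le (l : R) x : 0 <= l -> rnorm ip (T (E l x)) <= l * rnorm ip (E l x).
Proof.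
move=> l0; have lT := mor_linear mT; have lE := mor_linear (sproj_mor mT sT l).
pose D z := T (E l z).
have lD : linear D by exact: linear_comp lT lE.
have sD z w : <<D z, w>> = <<z, D w>> by rewrite /D sproj_commT sproj_sym sT.
have DE z : <<D z, z>> = <<T (E l z), E l z>>.
  by rewrite /D -sproj_sym -sproj_commT sproj_idem.
have D0 z : 0 <= <<D z, z>> by rewrite DE.
have DM z : <<D z, z>> <= l * <<z, z>>.
  rewrite DE; apply: le_trans (sproj_le _ _ _ _) _; rewrite ler_wpM2l//.
  by rewrite -!rnorm_sq ler_sqr ?nnegrE ?rnorm_ge0// sproj_norm.
have := pos_op_norm lD (rip_adjoint lD sD) D0 l0 DM (E l x).
rewrite /D sproj_idem => h; rewrite rnorm_leP ?mulr_ge0 ?rnorm_ge0// exprMn rnorm_sq.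
by apply: le_trans h _; rewrite expr2 -mulrA ler_wpM2l// sproj_le.
Qed.

End SpectralFamilyAxioms.

Lemma complex_subrBK {R : realType} (a b c : R[i]) : a - b - (a - c) = c - b.
Proof. by rewrite opprB addrC addrA subrK. Qed.

Lemma normr_complexB {R : realType} (x y : R) :
  `|x%:C%C - y%:C%C : R[i]| = `|x - y|%:C%C.
Proof. by rewrite -rmorphB normc_def /= expr0n addr0 sqrtr_sqr. Qed.

Section TraceCumulative.
Context {R : realType} {C : hvn_category R} {A : C}.
Local Notation ip := (cip A).
Local Notation "<< x , y >>" := (rip ip x y) (at level 0, format "<< x ,  y >>").
Variables (T : A -> A).
Hypotheses (mT : mor T) (sT : rsym T) (T0 : forall x, 0 <= <<T x, x>>).
Local Notation E := (sproj mT sT).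
Variable tau : trace C.
Hypotheses (tau_ge0 : trace_ge0 tau) (tau_normal : trace_normal tau).

Lemma traceB (H : C) (f g : H -> H) : mor f -> mor g ->
  tau H (fun x => f x - g x) = tau H f - tau H g.
Proof.
move=> mf mg; have := tr_linear tau (-1) mg mf.
rewrite mulN1r addrC => <-; congr (tau H _); apply/funext => x.
by rewrite scaleN1r addrC.
Qed.

Lemma trace0 (H : C) : tau H (fun=> 0) = 0.
Proof.
have := @traceB H _ _ (mor_id H) (mor_id H); rewrite subrr => <-.
by congr (tau H _); apply/funext => x; rewrite subrr.
Qed.

Lemma op_leP (S U : A -> A) : linear S -> linear U -> rsym S -> rsym U ->
  (forall x, <<S x, x>> <= <<U x, x>>) -> op_le ip S U.
Proof.
move=> lS lU sS sU h x.
have real (V : A -> A) : linear V -> rsym V -> complex.Im (ip (V x) x) = 0.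
  by move=> lV sV; apply: selfadj_Im; exact: rip_adjoint.
by rewrite lecE !real// eqxx; exact: h.
Qed.

(** Right continuity at [l] is normality of the trace for the increasing net of
    the operators [1 - E m], [l < m], with supremum [1 - E l]. *)
Lemma sproj_trace_cumulative : exists F : cumulative R R,
  forall l, tau A (E l) = (F l)%:C%C.
Proof.
have mE l := sproj_mor mT sT l.
have lE l := mor_linear (mE l).
have tauE l : tau A (E l) = (complex.Re (tau A (E l)))%:C%C.
  have : 0 <= tau A (E l).
    by apply: tau_ge0 => //; apply/funext => x; exact: sproj_idem.
  by rewrite lecE; case: (tau A (E l)) => a b /= /andP[/eqP -> _].
have tauB l m : l <= m -> complex.Re (tau A (E l)) <= complex.Re (tau A (E m)).
  move=> lm; have : 0 <= tau A (fun x => E m x - E l x).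
    apply: tau_ge0; first exact: morB.
    apply/funext => x /=; rewrite (linB (lE m)) (linB (lE l)) !sproj_idem.
    by rewrite (sproj_comm _ _ l m) !(sproj_mono _ _ _ lm) subrr subr0.
  by rewrite traceB// lecE => /andP[_]; rewrite /= ReB subr_ge0.
suff [F FE] : exists F : cumulative R R, F = (fun l => complex.Re (tau A (E l))) :> (R -> R).
  by exists F => l; rewrite FE.
apply: cumulative_ex; first exact: tauB.
move=> l.
pose S m (x : A) := x - E m x.
have mS m : mor (S m) by apply: morB => //; exact: mor_id.
have lS m := mor_linear (mS m).
have sS m : rsym (S m) by move=> x y; rewrite /S !ripE sproj_sym.
have SS m m' : m' <= m -> op_le ip (S m) (S m').
  move=> mm; apply: op_leP => // x.
  by rewrite /S !ripE lerD2l lerN2 sproj_quad_mono.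
pose D := [set U | exists2 m, l < m & U = S m].
have := tau_normal (cip_C_adm A) (D := D) (T := S l).
have D0 : D !=set0 by exists (S (l + 1)), (l + 1) => //; rewrite ltrDl.
have Dpos U : D U -> mor U /\ op_ge0 ip U.
  move=> [m _ ->]; split => //; apply: op_leP => //.
  - by move=> a x y; rewrite scaler0 addr0.
  - by move=> x y; rewrite rip0l rip0r.
  - move=> x; rewrite rip0l /S !ripE subr_ge0 -sproj_rip -!rnorm_sq.
    by rewrite ler_sqr ?nnegrE ?rnorm_ge0// sproj_norm.
have Ddir U1 U2 : D U1 -> D U2 -> exists U, [/\ D U, op_le ip U1 U & op_le ip U2 U].
  move=> [m1 lm1 ->] [m2 lm2 ->]; exists (S (Num.min m1 m2)); split.
  - by exists (Num.min m1 m2) => //; rewrite lt_min lm1.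
  - by apply: SS; rewrite ge_min lexx.
  - by apply: SS; rewrite ge_min lexx orbT.
have Dub U : D U -> op_le ip U (S l) by move=> [m lm ->]; apply: SS; exact: ltW.
have Dlub U : mor U -> (forall V, D V -> op_le ip V U) -> op_le ip (S l) U.
  move=> mU hU x.
  have hm m : l < m -> complex.Im (ip (U x) x) = complex.Im (ip (S m x) x) /\
      <<S m x, x>> <= <<U x, x>>.
    move=> lm; have : ip (S m x) x <= ip (U x) x by apply: hU; exists m.
    by rewrite lecE => /andP[/eqP].
  have ImS m : complex.Im (ip (S m x) x) = 0.
    by apply: selfadj_Im; exact: (rip_adjoint (lS m) (sS m)).
  have l1 : l < l + 1 by rewrite ltrDl.
  rewrite lecE ImS (hm _ l1).1 ImS eqxx /=.
  rewrite -/(rip ip (S l x) x) -/(rip ip (U x) x) /S !ripE lerBlDr -lerBlDl.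
  have lim : <<E m x, x>> @[m --> l^'+] --> <<E l x, x>>.
    exact: sproj_quad_right_continuous.
  apply: (cvgr_to_ge lim); near=> m.
  have lm : l < m by near: m; exact: nbhs_right_gt.
  by have := (hm m lm).2; rewrite /S !ripE lerBlDr -lerBlDl.
move=> /(_ D0 Dpos Ddir (mS l) Dub Dlub) {}h.
apply/cvgrPdist_lt => e e0.
have [|_ [m lm ->] hm] := h e%:C%C; first by rewrite ltcR.
near=> m'.
have m'm : m' <= m by near: m'; exact: nbhs_right_le.
have lm' : l < m' by near: m'; exact: nbhs_right_gt.
have {hm} : `|tau A (S l) - tau A (S m')| < e%:C%C.
  by apply: hm; [exists m' | exact: SS].
rewrite !traceB//; try exact: mor_id.
by rewrite complex_subrBK (tauE m') (tauE l) normr_complexB ltcR distrC.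
Unshelve. all: end_near. Qed.

End TraceCumulative.

Section TraceComparison.
Context {R : realType} {C : hvn_category R} (tau : trace C).
Hypothesis tau_ge0 : trace_ge0 tau.
Implicit Types A B L : C.

(** Since [u] maps the image [L] of [p] into that of [q] and is bounded below
    on it, [u] restricted to [L] has a retraction [v]. Then [p] and the
    idempotent [u v q], whose difference from [q] is again idempotent, both
    have the trace of the identity of [L] by cyclicity. *)
Lemma trace_idem_le A B (p : A -> A) (q : B -> B) (u : A -> B) (c : R) :
  mor p -> mor q -> mor u -> (forall x, p (p x) = p x) -> (forall y, q (q y) = q y) ->
  (forall x, q (u x) = u x) -> 0 < c ->
  (forall x, c * rnorm (cip A) (p x) <= rnorm (cip B) (u (p x))) ->
  tau A p <= tau B q.
Proof.
move=> mp mq mu pp qq qu c0 hu.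
have lp := mor_linear mp; have lq := mor_linear mq.
have [L [k [mk kE]]] := mor_kernel (morB (mor_id A) mp).
have [_ _ rk _] := kE.
have [vk [mvk vkK _]] := inclusion_retraction mk kE.
have pk y : p (k y) = k y.
  have : range k (k y) by []. 
  by rewrite rk /= => /subr0_eq.
have kp x : exists y, k y = p x.
  have : ((fun x => id x - p x) @^-1` [set 0]) (p x) by rewrite /= pp subrr.
  by rewrite -rk => -[y _ <-]; exists y.
have kw x : k (vk (p x)) = p x by have [y <-] := kp x; rewrite vkK.
have taup : tau A p = tau L id.
  have := tr_cyclic tau (mor_comp mvk mp) mk.
  have -> : k \o (vk \o p) = p by apply/funext => x /=.
  by move=> ->; congr (tau L _); apply/funext => y /=; rewrite pk vkK.
have [d d0 kd] := subspace_bounded_below (cip_adm L) (cip_adm A) kE.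
have [|x|v [mv vK _]] := bounded_below_retraction (mor_comp mu mk) (c := c * d).
- exact: mulr_gt0.
- rewrite /= -pk -mulrA; apply: le_trans (hu _).
  by rewrite pk ler_wpM2l// ltW.
pose t := u \o k.
have mt : mor t by exact: mor_comp.
pose e := t \o (v \o q).
have me : mor e by apply: mor_comp => //; exact: mor_comp.
have qt y : q (t y) = t y by exact: qu.
have taue : tau B e = tau L id.
  rewrite (tr_cyclic tau (mor_comp mv mq) mt); congr (tau L _).
  by apply/funext => y /=; rewrite -/(t y) qt vK.
have : 0 <= tau B (fun y => q y - e y).
  apply: tau_ge0; first exact: morB.
  apply/funext => y /=; rewrite (linB lq) (linB (mor_linear me)) qq.
  have -> : q (e y) = e y by rewrite /e /= -/(t _) qt.
  have -> : e (q y) = e y by rewrite /e /= qq.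
  have -> : e (e y) = e y by rewrite /e /= -/(t _) qt vK.
  by rewrite subrr subr0.
by rewrite traceB// subr_ge0 taup taue.
Qed.

End TraceComparison.

Section GivenSpectralFamily.
Context {R : realType} {H : topologicalLmodType R[i]} (ip : {dot H for conjC})
  (T : H -> H) (E : R -> H -> H).
Hypotheses (hip : admissible ip) (lT : linear T) (T0 : op_ge0 ip T)
  (TE : is_spectral_family ip T E).

Let quad (l : R) y : rip ip (E l y) y = rip ip (E l y) (E l y).
Proof.
have [/(_ l)[EE sE] _ _ _ _] := TE.
by rewrite [RHS](adjoint_rip sE) -[E l (E l y)]/((E l \o E l) y) EE -(adjoint_rip sE).
Qed.

(** The integral formula alone gives this: the part of the integral beyond [mu]
    is at least [mu] times the mass there. *)
Lemma spectral_family_lower (mu : R) y : 0 <= mu ->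
  mu * rip ip (y - E mu y) (y - E mu y) <= rip ip (T y) y.
Proof.
move=> mu0; have [_ _ _ [_ Einf] /(_ y)[F [FE intF]]] := TE.
have {}FE l : F l = rip ip (E l y) y by rewrite /rip FE.
have -> : rip ip (y - E mu y) (y - E mu y) = rip ip y y - F mu.
  by rewrite FE !ripE -quad (ripC ip y); lra.
have bound N : mu <= N -> mu * (F N - F mu) <= rip ip (T y) y.
  move=> muN; rewrite -lee_fin -[leRHS]intF.
  have ab : 0 <= mu <= N by rewrite mu0.
  have /andP[h _] := stieltjes_id_bounds F ab.
  apply: le_trans h _; apply: ge0_subset_integral => //.
  - by move=> x /=; rewrite in_itv/= andbT lee_fin.
  - move=> x /=; rewrite !in_itv/= andbT => /andP[/ltW + _]; exact: le_trans.
have h : mu * (F l - F mu) @[l --> +oo] --> mu * (rip ip y y - F mu).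
  apply: cvgM; first exact: cvg_cst.
  apply: cvgB; last exact: cvg_cst.
  rewrite (_ : (F : R -> R) = fun l => rip ip (E l y) y); last exact/funext.
  by apply: rip_cvg; apply/(adm_cvg hip); exact: Einf.
apply: (cvgr_to_le h); near=> N; apply: bound.
by near: N; apply: nbhs_pinfty_ge; exact: num_real.
Unshelve. all: end_near. Qed.

(** At a vector in the image of [E 0] the spectral measure is concentrated at
    the origin, where the integrand vanishes. *)
Lemma spectral_family_kernel (y : H) : (forall z, T z = 0 -> z = 0) -> E 0 y = 0.
Proof.
move=> Tinj; set z := E 0 y.
have [_ Emono _ [Eneg _] /(_ z)[F [FE intF]]] := TE.
have {}FE l : F l = rip ip (E l z) z by rewrite /rip FE.
apply: Tinj; apply: (pos_op_eq0 (ip := ip) lT (op_ge0_selfadj lT T0)).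
  by move=> w; have := T0 w; rewrite linear0l lecE => /andP[].
have Fc l : 0 <= l -> F l = rip ip z z.
  move=> l0; rewrite FE; congr rip; rewrite /z.
  by have [_ h] := Emono _ _ l0; rewrite -[LHS]/((E l \o E 0) y) h.
apply: EFin_inj; rewrite -[LHS]intF.
rewrite (@stieltjes_id_integral _ _ (fun=> 0) 1) ?subrr//.
- by move=> a b /andP[a0 ab]; rewrite !Fc ?subrr ?mulr0 ?lexx// (le_trans a0).
- by move=> l l1; rewrite !Fc// (le_trans ler01).
Qed.

End GivenSpectralFamily.

(** * Homotopy invariance of tau-isomorphisms *)

Section TauIsomorphisms.
Context {R : realType} {C : hvn_category R} (tau : trace C).
Hypotheses (tau_ge0 : trace_ge0 tau) (tau_normal : trace_normal tau).
Implicit Types A B : C.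

(** The modulus and its resolution are built for the scalar products [cip],
    which leaves only the integrability of the logarithm to be proved. *)
Lemma tau_isomorphism_intro A' A (al : A' -> A) :
  mor al -> injective al -> dense (range al) ->
  (forall (T : A' -> A') (mT : mor T) (sT : rsym T) (F : cumulative R R),
     (forall x, 0 <= rip (cip A') (T x) x) ->
     (forall x, rip (cip A') (T x) (T x) = rip (cip A) (al x) (al x)) ->
     (forall l, tau A' (sproj mT sT l) = (F l)%:C%C) ->
     (-oo < \int[lebesgue_stieltjes_measure F]_(l in `]0%R, +oo[) (ln l)%:E)%E) ->
  tau_isomorphism tau al.
Proof.
move=> mal inj dal h; split => //.
have [als mals adj] := cadjoint mal.
have [|x y|x|T [mT sT T0 TT _]] := @positive_sqrt _ _ _ (als \o al).
- exact: mor_comp.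
- by rewrite /= -(adjoint_rip adj) ripC -(adjoint_rip adj) ripC.
- by rewrite /= ripC -(adjoint_rip adj) rip_ge0.
have [F FE] := sproj_trace_cumulative mT sT tau_ge0 tau_normal.
exists (cip A'), (cip A), T, (sproj mT sT), F; split.
- exact: cip_C_adm.
- exact: cip_C_adm.
- split; [exact: mor_linear | exact: mor_continuous | |].
    apply: op_leP => //; [|exact: mor_linear| |].
    - by move=> a x y; rewrite scaler0 addr0.
    - by move=> x y; rewrite rip0l rip0r.
    - by move=> x; rewrite rip0l.
  by exists als => //; apply/funext.
- exact: sproj_spectral_family.
split; first by move=> l; split => //; exact: sproj_mor.
by apply: (h T mT sT) => // x; rewrite sT TT (adjoint_rip adj).
Qed.

(** Near the origin the spectral density function of [al] is dominated by
    that of a homotopy equivalent [be] after a rescaling: [f'] is bounded below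
    on the spectral subspace of [al] for small [l], because
    [g' f' = 1 + F al], and it maps this subspace close to the spectral
    subspace of [be], because [be f' = f al]. *)
Lemma tau_isomorphism_transfer A' A B' B (al : A' -> A) (be : B' -> B)
    (f : A -> B) (f' : A' -> B') (g : B -> A) (g' : B' -> A') (F : A -> A') :
  mor al -> injective al -> dense (range al) -> tau_isomorphism tau be ->
  mor f -> mor f' -> mor g -> mor g' -> mor F ->
  (forall x, f (al x) = be (f' x)) -> (forall y, g (be y) = al (g' y)) ->
  (forall x, g (f x) - x = al (F x)) ->
  tau_isomorphism tau al.
Proof.
move=> mal inj dal [mbe binj _ [ipB' [ipB [S [E [G [cB' cB mS sE [EG intG]]]]]]]].
move=> mf mf' mg mg' mF fal gbe gf.
have [aB' _] := cB'; have [aB _] := cB.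
have [lS _ S0 [bes adjb SS]] := mS.
have sS := op_ge0_selfadj lS S0.
have SE y : rnorm ipB' (S y) = rnorm ipB (be y).
  rewrite /rnorm -(adjoint_rip sS) -[S (S y)]/((S \o S) y) SS /=.
  by rewrite ripC -(adjoint_rip adjb).
have homot x : g' (f' x) = x + F (al x).
  apply: inj; rewrite -gbe -fal (linD (mor_linear mal)) -gf.
  by rewrite addrC subrK.
apply: (tau_isomorphism_intro mal inj dal) => T mT sT Fa T0 TE FaE.
have nTE x : rnorm (cip A') (T x) = rnorm (cip A) (al x) by rewrite /rnorm TE.
have [Mf Mf0 hf] := mor_bounded (cip_adm A) aB mf.
have [Mg Mg0 hg] := mor_bounded aB' (cip_adm A') mg'.
have [MF MF0 hF] := mor_bounded (cip_adm A) (cip_adm A') mF.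
have [Mi Mi0 hi] := mor_bounded (cip_adm B') aB' (mor_id B').
have Fa_ge0 l : 0 <= Fa l.
  rewrite -ler0c -FaE; apply: tau_ge0; first exact: sproj_mor.
  by apply/funext => x; exact: sproj_idem.
have [Eproj _ _ _ _] := sE.
have EE l y : E l (E l y) = E l y by have [h _] := Eproj l; rewrite -[LHS]/((E l \o E l) y) h.
(* For [l <= 1 / (2 MF)] the term [F (al x)] is at most [|x| / 2]; the factor
   [8 Mf Mg] makes [|be y| <= mu |y| / 4] below, so that the component of [y]
   outside the spectral subspace has norm at most [|y| / 2]. *)
apply: (@log_integral_compare _ Fa G (8 * Mf * Mg) (2 * MF)^-1) => //.
- by rewrite !mulr_gt0.
- by rewrite invr_gt0 mulr_gt0.
- apply: complexI; rewrite -(EG 0).2 (_ : E 0 = fun=> 0) ?trace0//.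
  apply/funext => y.
  apply: (spectral_family_kernel lS S0 sE) => z Sz.
  apply: binj; rewrite (lin0 (mor_linear mbe)).
  by apply: (@rnorm_eq0 _ _ ipB); rewrite -SE Sz rnorm0.
move=> l /andP[l0 ll0]; set mu := 8 * Mf * Mg * l.
have mu0 : 0 < mu by rewrite /mu !mulr_gt0.
rewrite -lecR -FaE -(EG mu).2.
apply: (trace_idem_le tau_ge0 (u := E mu \o f') (c := (4 * Mg * Mi)^-1)).
- exact: sproj_mor.
- exact: (EG mu).1.
- by apply: mor_comp mf'; exact: (EG mu).1.
- by move=> x; exact: sproj_idem.
- exact: EE.
- by move=> x /=; rewrite EE.
- by rewrite invr_gt0 !mulr_gt0.
move=> x0; set x := sproj mT sT l x0; rewrite ler_pdivrMl ?mulr_gt0//=.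
set y := f' x.
have alx : rnorm (cip A) (al x) <= l * rnorm (cip A') x.
  by rewrite -nTE; apply: sproj_norm_le => //; exact: ltW.
have Falx : rnorm (cip A') (F (al x)) <= 2^-1 * rnorm (cip A') x.
  apply: le_trans (hF _) _.
  apply: (@le_trans _ _ (MF * (l * rnorm (cip A') x))); first by rewrite ler_pM2l.
  rewrite mulrA ler_wpM2r ?rnorm_ge0//.
  by rewrite -ler_pdivlMl// -invfM mulrC.
have xy : rnorm (cip A') x <= 2 * Mg * rnorm ipB' y.
  have h1 : rnorm (cip A') x <= rnorm (cip A') (g' y) + rnorm (cip A') (F (al x)).
    have e : x = g' y - F (al x) by rewrite /y homot addrK.
    by rewrite {1}e rnormB.
  have := hg y; move: h1 Falx; lra.
have bey : rnorm ipB' (S y) <= mu / 4 * rnorm ipB' y.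
  rewrite SE /y -fal; apply: le_trans (hf _) _.
  apply: (@le_trans _ _ (Mf * (l * (2 * Mg * rnorm ipB' y)))).
    by rewrite ler_pM2l//; apply: le_trans alx _; rewrite ler_pM2l.
  by rewrite /mu le_eqVlt; apply/orP; left; apply/eqP; field.
set z := y - E mu y.
have zy : rnorm ipB' z <= 2^-1 * rnorm ipB' y.
  rewrite -ler_sqr ?nnegrE ?mulr_ge0 ?rnorm_ge0//.
  have h1 := spectral_family_lower aB' sE y (ltW mu0); rewrite -/z -rnorm_sq in h1.
  have h2 : rip ipB' (S y) y <= mu / 4 * rnorm ipB' y ^+ 2.
    apply: le_trans (ler_norm _) _; apply: le_trans (rip_le _ _ _) _.
    by rewrite expr2 mulrA ler_wpM2r ?rnorm_ge0.
  rewrite -(ler_pM2l mu0); apply: le_trans h1 _; apply: le_trans h2 _.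
  by rewrite le_eqVlt; apply/orP; left; apply/eqP; field.
have yE : rnorm ipB' y <= 2 * rnorm ipB' (E mu y).
  have := rnormD ipB' z (E mu y); rewrite subrK; move: zy; lra.
have Ei := hi (E mu y); rewrite /= in Ei.
apply: le_trans xy _.
apply: (@le_trans _ _ (2 * Mg * (2 * (Mi * rnorm (cip B') (E mu y))))).
  rewrite ler_pM2l ?mulr_gt0//; apply: le_trans yE _; by rewrite ler_pM2l.
by rewrite le_eqVlt; apply/orP; left; apply/eqP; ring.
Qed.

Lemma tau_isomorphism_zero : tau_isomorphism tau (fun _ : zero_obj C => 0 : zero_obj C).
Proof.
apply: tau_isomorphism_intro.
- exact: mor0.
- by move=> x y _; rewrite (zero_objP x) (zero_objP y).
- by move=> O [x Ox] _; exists x; split => //; exists x => //; rewrite (zero_objP x).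
move=> T mT sT F _ _ FE; apply/log_integral_series.
have F0 l : F l = 0.
  apply: complexI; rewrite -FE (_ : sproj _ _ _ = fun=> 0) ?trace0//.
  by apply/funext => x; exact: zero_objP.
rewrite eseries0 ?ltry// => k _ _; by rewrite !F0 subrr.
Qed.

End TauIsomorphisms.

(** * Closed images and coimages *)

Section Factorizations.
Context {R : realType} {C : hvn_category R}.
Implicit Types A B I Z Q : C.

Lemma factor_through A B Z (z : Z -> B) (V : set B) (f : A -> B) :
  mor z -> subspace_inclusion z V -> mor f -> range f `<=` V ->
  exists2 d : A -> Z, mor d & z \o d = f.
Proof.
move=> mz hz mf fV; have [v [mv zv _]] := inclusion_retraction mz hz.
have [_ _ rz _] := hz.
exists (v \o f); first exact: mor_comp.
apply/funext => x /=; have : V (f x) by apply: fV; exists x.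
by rewrite -rz => -[y _ <-]; rewrite zv.
Qed.

Lemma kernel_closed A B (f : A -> B) (V : set A) : mor f ->
  V `<=` f @^-1` [set 0] -> closure V `<=` f @^-1` [set 0].
Proof.
move=> mf Vf x Vx; have lf := mor_linear mf.
have [M M0 fM] := mor_bounded (cip_adm A) (cip_adm B) mf.
apply: (@rnorm_eq0 _ _ (cip B)); apply/eqP; rewrite eq_le rnorm_ge0 andbT.
apply/ler_addgt0Pr => e e0; rewrite add0r.
have [|y [Vy /= yx]] := Vx [set y | rnorm (cip A) (y - x) < e / M].
  by apply/(adm_nbhs (cip_adm A)); exists (e / M) => //; rewrite divr_gt0.
have -> : f x = f (x - y) by rewrite (linB lf) (Vf _ Vy) subr0.
apply: le_trans (fM _) _; rewrite rnormBC -ler_pdivlMl// mulrC; exact: ltW.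
Qed.

Lemma closure_image A B (f : A -> B) (V : set A) x : continuous f ->
  closure V x -> closure (f @` V) (f x).
Proof.
move=> cf Vx U /(cf x)/Vx[y [Vy Uy]]; exists (f y); split => //; by exists y.
Qed.

Lemma closure_subspace Z B (z : Z -> B) (V : set B) (S : set Z) (w : Z) :
  subspace_inclusion z V -> closure (z @` S) (z w) -> closure S w.
Proof.
move=> [_ zinj _ top] h U /top[W /h[_ [[s Ss <-] Ws]] WU].
by exists s; split => //; exact: WU.
Qed.

Lemma range_comp A B Z (z : Z -> B) (d : A -> Z) : range (z \o d) = z @` range d.
Proof.
apply/seteqP; split => [_ [x _ <-]|_ [_ [x _ <-] <-]]; last by exists x.
by exists (d x) => //; exists x.
Qed.

(** The closure of an image may be computed in a closed subspace containing
    it, because [z] is continuous and carries the induced topology; this passes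
    between the cycles, where torsion parts live, and the whole chain space. *)
Lemma closed_image_lift A B Z I (z : Z -> B) (V : set B) (d : A -> Z)
    (i : I -> Z) :
  mor z -> subspace_inclusion z V -> mor i ->
  is_closed_image (z \o d) (z \o i) -> is_closed_image d i.
Proof.
move=> mz hz mi [mzi [_ zi_inj zi_range zi_top]]; split => //.
have [_ zinj _ _] := hz.
split; first exact: mor_linear.
- by move=> x y xy; apply: zi_inj => /=; rewrite xy.
- apply/seteqP; split => [_ [y _ <-]|w hw].
    apply: (closure_subspace hz); rewrite -range_comp.
    by rewrite -zi_range; exists y.
  have := closure_image (mor_continuous mz) hw.
  by rewrite -range_comp -zi_range => -[y _ /zinj <-]; exists y.
move=> x U; split => [/zi_top[W Wx WU]|[W Wx WU]].
  by exists (z @^-1` W) => //; exact: (mor_continuous mz).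
by apply: filterS WU _; exact: (mor_continuous mi).
Qed.

Lemma closed_image_descend A B Z I (z : Z -> B) (V : set B) (d : A -> Z)
    (i : I -> Z) :
  mor z -> subspace_inclusion z V -> closure (range (z \o d)) `<=` V ->
  is_closed_image d i -> is_closed_image (z \o d) (z \o i).
Proof.
move=> mz hz clV [mi [_ iinj irange itop]].
have [_ zinj zrange ztop] := hz.
split; first exact: mor_comp.
split; first exact: mor_linear (mor_comp mz mi).
- by move=> x y /zinj/iinj.
- rewrite range_comp irange; apply/seteqP; split => [_ [w hw <-]|b hb].
    by rewrite range_comp; exact: closure_image (mor_continuous mz) hw.
  have := clV b hb; rewrite -zrange => -[w _ zw]; exists w => //.
  by apply: (closure_subspace hz); rewrite -range_comp zw.
move=> x U; split => [/itop[W /ztop[W' W'x W'W] WU]|[W Wx WU]].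
  by exists W' => // y /= /W'W/WU.
by apply: filterS WU _; exact: (mor_continuous (mor_comp mz mi)).
Qed.

(** The coimage is realized on the kernel of the orthogonal projection onto
    the kernel. *)
Lemma coimage_exists A B (f : A -> B) : mor f ->
  exists (Q : C) (q : A -> Q) (u : Q -> A),
    [/\ is_coimage f q, mor u, cancel u q & forall x, f (u (q x)) = f x].
Proof.
move=> mf; have lf := mor_linear mf.
have [p [mp pp _ fp pf]] := kernel_projection mf; have lp := mor_linear mp.
have [Q [u [mu hu]]] := mor_kernel mp.
have [_ _ urange _] := hu.
have m1p : mor (fun x => x - p x) by apply: morB => //; exact: mor_id.
have [|q mq uq] := factor_through mu hu m1p.
  by move=> _ [x _ <-]; rewrite /= (linB lp) pp subrr.
have uqE x : u (q x) = x - p x by rewrite -[LHS]/((u \o q) x) uq.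
have pu y : p (u y) = 0 by have : range u (u y) by []; rewrite urange.
have [v [mv uv _]] := inclusion_retraction mu hu.
have qu : cancel u q by move=> y; apply: (can_inj uv); rewrite uqE pu subr0.
have fuq x : f (u (q x)) = f x by rewrite uqE (linB lf) fp subr0.
exists Q, q, u; split => //; split => //; split.
- exact: mor_linear.
- by apply/seteqP; split => // y _; exists (u y).
- apply/seteqP; split => x /= h.
    by rewrite -fuq h (lin0 (mor_linear mu)) (lin0 lf).
  by apply: (can_inj uv); rewrite uqE pf// subrr (lin0 (mor_linear mu)).
move=> x U; split => [|h]; first exact: (mor_continuous mq).
have lu := mor_linear mu; have lq := mor_linear mq.
pose s y := x + u (y - q x).
have qs y : q (s y) = y by rewrite /s (linD lq) qu addrC subrK.
have sx : s (q x) = x by rewrite /s subrr (lin0 lu) addr0.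
have [M M0 uM] := mor_bounded (cip_adm Q) (cip_adm A) mu.
move: h => /(adm_nbhs (cip_adm A))[e e0 he].
apply/(adm_nbhs (cip_adm Q)); exists (e / M); first by rewrite divr_gt0.
move=> y yx; rewrite -(qs y); apply: he; rewrite /s [x + _]addrC addrK.
by apply: le_lt_trans (uM _) _; rewrite -ltr_pdivlMl// mulrC.
Qed.

(** The adjoint of a coimage projection is bounded below, by the open mapping
    property of the quotient topology; a section is the adjoint of a retraction
    of the adjoint. *)
Lemma coimage_section A B Q (f : A -> B) (q : A -> Q) : is_coimage f q ->
  exists2 u : Q -> A, mor u & cancel u q.
Proof.
move=> [mq [lq qsurj _ qtop]].
have [r r0 hr] : exists2 r : R, 0 < r &
    forall y, exists2 x, q x = y & rnorm (cip A) x <= r * rnorm (cip Q) y.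
  pose U := q @` [set x | rnorm (cip A) x < 1].
  have : nbhs (q 0) U.
    apply/qtop; apply/(adm_nbhs (cip_adm A)); exists 1 => // x.
    by rewrite subr0 => x1; exists x.
  rewrite (lin0 lq) => /(adm_nbhs (cip_adm Q))[e e0 he].
  exists (2 / e); first by rewrite divr_gt0.
  move=> y; have [y0|y0] := eqVneq (rnorm (cip Q) y) 0.
    exists 0; first by rewrite (lin0 lq) (rnorm_eq0 y0).
    by rewrite rnorm0 y0 mulr0.
  have yp : 0 < rnorm (cip Q) y by rewrite lt_def y0 rnorm_ge0.
  pose a := e / (2 * rnorm (cip Q) y).
  have a0 : 0 < a by rewrite divr_gt0// mulr_gt0.
  have [|x /= x1 qx] := he (a%:C%C *: y).
    by rewrite subr0 rnormZ gtr0_norm// (_ : a * _ = e / 2); [lra | rewrite /a; field].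
  exists (a^-1%:C%C *: x).
    by rewrite (linZ lq) qx scalerA -rmorphM mulVf ?gt_eqF// rmorph1 scale1r.
  rewrite rnormZ gtr0_norm ?invr_gt0//.
  apply: (@le_trans _ _ a^-1); first by rewrite ger_pMr ?invr_gt0// ltW.
  by rewrite /a invf_div mulrAC.
have [qs mqs /adjoint_rip adj] := cadjoint mq.
have [||v [mv vK _]] := bounded_below_retraction mqs (c := r^-1).
- by rewrite invr_gt0.
- move=> y; rewrite ler_pdivrMl//; have [x qx xr] := hr y.
  have [->|y0] := eqVneq (rnorm (cip Q) y) 0; first by rewrite mulr_ge0 ?rnorm_ge0// ltW.
  have yp : 0 < rnorm (cip Q) y by rewrite lt_def y0 rnorm_ge0.
  rewrite -(ler_pM2r yp) -expr2 rnorm_sq -{1}qx adj.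
  apply: le_trans (ler_norm _) _; apply: le_trans (rip_le _ _ _) _.
  by rewrite mulrC [_ * rnorm _ (qs y)]mulrC -mulrA ler_wpM2l ?rnorm_ge0.
have [u mu /adjoint_rip adju] := cadjoint mv.
exists u => // y; apply: (@rip_ext _ _ (cip Q)) => w.
by rewrite adj ripC -adju vK ripC.
Qed.

End Factorizations.

(** * Extended cohomology and the determinant class *)

Section ExtendedCohomology.
Context {R : realType} {C : hvn_category R} (tau : trace C).
Hypotheses (tau_ge0 : trace_ge0 tau) (tau_normal : trace_normal tau).
Variables (n : nat) (K : complex_in C n).

Lemma cdiff_mor i : mor (@cdiff _ _ _ K i).
Proof. by case: i => [|j]; [exact: mor0 | exact: bd_hom]. Qed.

Lemma cdiff_cdiff i (x : cob_pred K i) : @cdiff _ _ _ K i.+1 (@cdiff _ _ _ K i x) = 0.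
Proof.
case: i x => [x|j x]; last exact: bd_bd.
exact: (lin0 (mor_linear (cdiff_mor 1))).
Qed.

Lemma closure_range_cdiff i :
  closure (range (@cdiff _ _ _ K i)) `<=` @cdiff _ _ _ K i.+1 @^-1` [set 0].
Proof.
apply: (kernel_closed (cdiff_mor i.+1)).
by move=> _ [x _ <-]; exact: cdiff_cdiff.
Qed.

Lemma ext_cohomology_exists i : exists (Z : C) (z : Z -> cob K i)
  (d : cob_pred K i -> Z), [/\ is_kernel (@cdiff _ _ _ K i.+1) z, mor d & z \o d = @cdiff _ _ _ K i].
Proof.
have [Z [z [mz hz]]] := mor_kernel (cdiff_mor i.+1).
have [|d md zd] := factor_through mz hz (cdiff_mor i).
  by move=> _ [x _ <-]; exact: cdiff_cdiff.
by exists Z, z, d.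
Qed.

Lemma ext_eq_refl (X Y : ext_obj C) (f : etgt X -> etgt Y) :
  ext_eq (X := X) (Y := Y) f f.
Proof.
exists (fun=> 0); first exact: mor0.
by move=> x; rewrite subrr (lin0 (mor_linear (emap_hom Y))).
Qed.

Lemma ext_iso_refl (X : ext_obj C) : ext_iso X X.
Proof.
have rep : ext_rep (X := X) (Y := X) id.
  by split; [exact: mor_id | exists id => //; exact: mor_id].
by exists id, id; split => //; exact: ext_eq_refl.
Qed.

(** In degree zero the image is the zero subspace. *)
Lemma tau_trivial_degree0 : exists X Y : ext_obj C,
  [/\ is_ext_cohomology K 0 X, is_torsion_part X Y & tau_trivial tau Y].
Proof.
have [Z [z [d [kz md zd]]]] := ext_cohomology_exists 0.
have mi := mor0 (zero_obj C) Z.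
have ma := mor0 (zero_obj C) (zero_obj C).
have d0 x : d x = 0 by rewrite (zero_objP x) (lin0 (mor_linear md)).
exists (ExtObj md), (ExtObj ma); split.
- by exists Z, z, d, md.
- exists (zero_obj C), (fun=> 0), (fun=> 0), ma; split => //; last first.
    by apply/funext => x; rewrite /= d0.
  split => //; split.
  + exact: mor_linear.
  + by move=> x y _; rewrite (zero_objP x) (zero_objP y).
  + apply/seteqP; split => [_ [x _ <-]|y hy].
      by apply: subset_closure; exists 0 => //=; rewrite d0.
    exists 0 => //; apply/esym.
    have := @kernel_closed _ _ _ _ id (range d) (mor_id Z); apply => //.
    by move=> _ [x _ <-]; rewrite /= d0.
  + move=> x U; split => [xU|[W Wx WU]].
      exists setT; first exact: filterT.
      by move=> y _; rewrite (zero_objP y) -(zero_objP x); exact: nbhs_singleton.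
    by apply: filterS WU _; exact: (mor_continuous mi).
have [_ _ dn _] := tau_isomorphism_zero tau_ge0 tau_normal.
split; first exact: dn.
exists (ExtObj ma); split; first exact: ext_iso_refl.
exact: tau_isomorphism_zero.
Qed.

(** The torsion part is isomorphic to the induced map on the coimage: the
    isomorphism is represented by identities, lifted to the sources by the
    projection [q] and by a section of it. *)
Lemma determinant_class_torsion j :
  (exists (Q I : C) (q : cob_pred K j -> Q) (i : I -> cob K j) (d : Q -> I),
      [/\ is_coimage (@cdiff _ _ _ K j) q, is_closed_image (@cdiff _ _ _ K j) i,
          i \o d \o q = @cdiff _ _ _ K j & tau_isomorphism tau d]) ->
  exists X Y : ext_obj C,
    [/\ is_ext_cohomology K j X, is_torsion_part X Y & tau_trivial tau Y].
Proof.
move=> [Q [I [q [i [d [cq ci idq td]]]]]].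
have [Z [z [d0 [kz md0 zd0]]]] := ext_cohomology_exists j.
have [mz hz] := kz; have [mi hi] := ci; have [mq [_ qsurj _ _]] := cq.
have [md _ dd _] := td.
have [_ _ irange _] := hi.
have [|i' mi' zi'] := factor_through mz hz mi.
  by rewrite irange; exact: closure_range_cdiff.
have ma : mor (d \o q) by exact: mor_comp.
have ci' : is_closed_image d0 i'.
  by apply: (closed_image_lift mz hz mi'); rewrite zd0 zi'.
have [_ zinj _ _] := hz.
exists (ExtObj md0), (ExtObj ma); split.
- by exists Z, z, d0, md0.
- exists I, i', (d \o q), ma; split => //.
  apply/funext => x; apply: zinj.
  by rewrite -[LHS]/((z \o i') (d (q x))) zi' -[RHS]/((z \o d0) x) zd0 -idq.
have [u mu qu] := coimage_section cq.
have raq : range (d \o q) = range d.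
  apply/seteqP; split => [_ [x _ <-]|_ [y _ <-]]; first by exists (q x).
  by exists (u y) => //=; rewrite qu.
split; first by rewrite /is_torsion /= raq.
exists (ExtObj md); split => //.
exists id, id; split; last 2 first.
- exact: ext_eq_refl.
- exact: ext_eq_refl.
- by split; [exact: mor_id | exists q].
- split; first exact: mor_id.
  by exists u => //; apply/funext => y /=; rewrite qu.
Qed.

(** An isomorphism between the torsion part and a tau-isomorphism restricts,
    along a section of the coimage projection, to the homotopy data that
    [tau_isomorphism_transfer] requires. *)
Lemma torsion_determinant_class j (X Y : ext_obj C) :
  is_ext_cohomology K j X -> is_torsion_part X Y -> tau_trivial tau Y ->
  exists (Q I : C) (q : cob_pred K j -> Q) (i : I -> cob K j) (d : Q -> I),
    [/\ is_coimage (@cdiff _ _ _ K j) q, is_closed_image (@cdiff _ _ _ K j) i,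
        i \o d \o q = @cdiff _ _ _ K j & tau_isomorphism tau d].
Proof.
move=> [Z [z [d0 [md0 [[mz hz] zd0 ->]]]]] [I [i [a [ma [ci ia ->]]]]].
move=> [tors [W [[f [g [[mf [f' mf' ff']] [mg [g' mg' gg']] [F mF gf] _]]] tW]]].
rewrite /= in f g mf f' mf' ff' mg g' mg' gg' F mF gf i ci ia tors.
have [Q [q [u [cq mu qu fuq]]]] := coimage_exists (cdiff_mor j).
have [mi [_ iinj _ _]] := ci; have [_ zinj _ _] := hz; have [mq _] := cq.
have zia x : z (i (a x)) = @cdiff _ _ _ K j x.
  by rewrite -zd0 -[RHS]/(z (d0 x)) -ia.
have auq x : a (u (q x)) = a x.
  by apply: iinj; apply: zinj; rewrite !zia.
exists Q, I, q, (z \o i), (a \o u); split => //.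
- rewrite -zd0; apply: (closed_image_descend mz hz) => //.
  by rewrite zd0; exact: closure_range_cdiff.
- by apply/funext => x /=; rewrite zia.
have mau : mor (a \o u) by exact: mor_comp.
have lau := mor_linear mau.
apply: (tau_isomorphism_transfer (be := @emap _ _ W) (f := f) (f' := f' \o u)
  (g := g) (g' := q \o g') (F := q \o F) tau_ge0 tau_normal) => //.
- move=> x y /= xy; have [_ [_ _ qker _]] := cq.
  apply/subr0_eq; rewrite -[LHS]qu.
  suff : (q @^-1` [set 0]) (u (x - y)) by [].
  by rewrite qker /= -zia -[a _]/((a \o u) _) (linB lau) /= xy subrr
    (lin0 (mor_linear mi)) (lin0 (mor_linear mz)).
- have -> : range (a \o u) = range a; last exact: tors.
  apply/seteqP; split => [_ [x _ <-]|_ [x _ <-]]; first by exists (u x).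
  by exists (q x) => //=; rewrite auq.
- exact: mor_comp.
- exact: mor_comp.
- exact: mor_comp.
- by move=> x /=; rewrite -[LHS]/((f \o a) (u x)) ff'.
- by move=> y /=; rewrite auq -[LHS]/((g \o @emap _ _ W) y) gg'.
- by move=> x /=; rewrite auq -gf.
Qed.

End ExtendedCohomology.

Theorem lemma9p2 (R : realType) (C : hvn_category R) (tau : trace C)
    (htau_ge0 : trace_ge0 tau) (htau_normal : trace_normal tau)
    (htau_faithful : trace_faithful tau) (n : nat) (K : complex_in C n) :
  determinant_class K tau <->
  (forall i : nat, (i <= n)%N ->
     exists X Y : ext_obj C,
       [/\ is_ext_cohomology K i X, is_torsion_part X Y & tau_trivial tau Y]).
Proof.
split => [h [_|j jn]|h j /andP[_ jn]].
- exact: tau_trivial_degree0.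
- by apply: determinant_class_torsion; apply: h.
have [X [Y [hX hY tY]]] := h j jn.
exact: torsion_determinant_class hX hY tY.
Qed.
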